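(* Let $A\in\mathcal{R}(\mathbb{T},\mathbb{H}^{n\times n})$ and let $M(t)$ be a solution matrix of $\phi^\Delta(t)=A(t)\phi(t)$, with Wronskian $W(t)=\det\chi_M(t)$. Then for all $t,t_0\in\mathbb{T}$ $$W(t)=E_u(t,t_0)\,W(t_0),$$ where $u=\sum_{k=1}^{2n}\mu^{k-1}\mathcal{V}_k(\chi_A)$.
   Context: A time scale $\mathbb{T}$ is a nonempty closed subset of $\mathbb{R}$. For $t\in\mathbb{T}$: $\sigma(t)=\inf\{s\in\mathbb{T}:s>t\}$, $\rho(t)=\sup\{s\in\mathbb{T}:s<t\}$ (with $\inf\emptyset=\sup\mathbb{T}$, $\sup\emptyset=\inf\mathbb{T}$), $\mu(t)=\sigma(t)-t$. The point $t$ is right-dense if $\sigma(t)=t$ and left-dense if $\rho(t)=t$. $\mathbb{T}^\kappa=\mathbb{T}\setminus(\rho(\sup\mathbb{T}),\sup\mathbb{T}]$ if $\sup\mathbb{T}<\infty$, and $\mathbb{T}^\kappa=\mathbb{T}$ otherwise. $\mathbb{H}$ is the skew field of quaternions with units $i,j,k$. A function $f:\mathbb{T}\to\mathbb{H}$ has delta derivative $f^\Delta(t)$ at $t\in\mathbb{T}^\kappa$ if for every $\varepsilon>0$ there is $\delta>0$ with $|f(\sigma(t))-f(s)-f^\Delta(t)(\sigma(t)-s)|\le\varepsilon|\sigma(t)-s|$ for all $s\in(t-\delta,t+\delta)\cap\mathbb{T}$. $f$ is rd-continuous if each of its four real components is continuous at right-dense points and has finite left-sided limits at left-dense points. For vector-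 and matrix-valued functions these notions are entrywise. For rd-continuous $f$, $\int_r^s f(t)\Delta t=F(s)-F(r)$, where $F^\Delta=f$ on $\mathbb{T}^\kappa$. $\mathcal{R}(\mathbb{T},\mathbb{H}^{n\times n})$ is the set of rd-continuous $A:\mathbb{T}\to\mathbb{H}^{n\times n}$ that are regressive, i.e. $I_n+\mu(t)A(t)$ is invertible for all $t\in\mathbb{T}^\kappa$. A solution of $\phi^\Delta=A\phi$ is a delta differentiable $\phi:\mathbb{T}\to\mathbb{H}^n$ with $\phi^\Delta(t)=A(t)\phi(t)$ for all $t\in\mathbb{T}^\kappa$. A solution matrix is an $n\times n$ matrix function $M(t)=(x_1(t),\dots,x_n(t))$ whose columns are solutions. Every quaternion matrix $Q$ is uniquely $Q=Q_1+Q_2j$ with $Q_1,Q_2$ complex matrices, and its complex adjoint matrix is $\chi_Q=\begin{pmatrix}Q_1&Q_2\\-\overline{Q_2}&\overline{Q_1}\end{pmatrix}$. For a $2n\times2n$ complex matrix $B$, $\mathcal{V}_k(B)=\sum_{\Lambda}\det B(\Lambda)$, the sum over all $k$-element subsets $\Lambda\subseteq\{1,\dots,2n\}$, where $B(\Lambda)$ is the principal submatrix of $B$ with rows and columns indexed by $\Lambda$ (the sum of all $k\times k$ principal minors). For a quaternion $q$ with scalar part $\Re(q)$ and vector part $\Im(q)$, the principal logarithm of $q\ne0$ is $\mathrm{Ln}(q)=\ln|q|+\frac{\Im(q)}{|\Im(q)|}\arccos\frac{\Re(q)}{|q|}$ if $q\notin\mathbb{R}$, and $\mathrm{Ln}(q)=\ln|q|+i\pi\frac{1-\mathrm{sgn}(q)}{2}$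 if $q\in\mathbb{R}$. Let $\xi_h(q)=\frac1h\mathrm{Ln}(1+qh)$ for $h>0$ and $\xi_0(q)=q$. For an rd-continuous $p:\mathbb{T}\to\mathbb{H}$ with $1+\mu p\neq0$ on $\mathbb{T}^\kappa$, $E_p(t,s)=\exp\left(\int_s^t\xi_{\mu(\tau)}(p(\tau))\Delta\tau\right)$, with $\exp(q)=\sum_{n\ge0}q^n/n!$. *)

(* Defs.v *)
From HB Require Import structures.
From mathcomp Require Import all_boot all_order all_algebra.
From mathcomp Require Import complex ring.
From mathcomp Require Import all_classical all_reals all_analysis.

Set Implicit Arguments.
Unset Strict Implicit.
Unset Printing Implicit Defensive.

Import Order.TTheory GRing.Theory Num.Theory.
Import numFieldNormedType.Exports.

Local Open Scope classical_set_scope.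
Local Open Scope ring_scope.

(** * Quaternions *)

Record quat (R : realType) := Quat { qre : R ; qi : R ; qj : R ; qk : R }.

Section QuatRing.
Variable R : realType.
Local Notation H := (quat R).

Definition quat_tuple (q : H) : R * R * R * R := (qre q, qi q, qj q, qk q).
Definition tuple_quat (u : R * R * R * R) : H :=
  let: (a, b, c, d) := u in Quat a b c d.
Lemma quat_tupleK : cancel quat_tuple tuple_quat. Proof. by case. Qed.

HB.instance Definition _ := Equality.copy H (can_type quat_tupleK).
HB.instance Definition _ := Choice.copy H (can_type quat_tupleK).

Definition quat_add (p q : H) : H :=
  Quat (qre p + qre q) (qi p + qi q) (qj p + qj q) (qk p + qk q).
Definition quat_opp (p : H) : H := Quat (- qre p) (- qi p) (- qj p) (- qk p).
Definition quat_mul (p q : H) : H :=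
  Quat (qre p * qre q - qi p * qi q - qj p * qj q - qk p * qk q)
       (qre p * qi q + qi p * qre q + qj p * qk q - qk p * qj q)
       (qre p * qj q - qi p * qk q + qj p * qre q + qk p * qi q)
       (qre p * qk q + qi p * qj q - qj p * qi q + qk p * qre q).

Lemma quat_addA : associative quat_add.
Proof. by move=> p q r; congr Quat; rewrite /= addrA. Qed.
Lemma quat_addC : commutative quat_add.
Proof. by move=> p q; congr Quat; rewrite /= addrC. Qed.
Lemma quat_add0 : left_id (Quat 0 0 0 0) quat_add.
Proof. by case=> a b c d; congr Quat; rewrite /= add0r. Qed.
Lemma quat_addN : left_inverse (Quat 0 0 0 0) quat_opp quat_add.
Proof. by case=> a b c d; congr Quat; rewrite /= addNr. Qed.

HB.instance Definition _ := GRing.isZmodule.Build H quat_addA quat_addC quat_add0 quat_addN.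

Lemma quat_mulA : associative quat_mul.
Proof. by move=> p q r; congr Quat => /=; ring. Qed.
Lemma quat_mul1l : left_id (Quat 1 0 0 0) quat_mul.
Proof. by case=> a b c d; congr Quat => /=; ring. Qed.
Lemma quat_mul1r : right_id (Quat 1 0 0 0) quat_mul.
Proof. by case=> a b c d; congr Quat => /=; ring. Qed.
Lemma quat_mulDl : left_distributive quat_mul quat_add.
Proof. by move=> p q r; congr Quat => /=; ring. Qed.
Lemma quat_mulDr : right_distributive quat_mul quat_add.
Proof. by move=> p q r; congr Quat => /=; ring. Qed.
Lemma quat_one_neq0 : Quat 1 0 0 0 != 0 :> H.
Proof. by apply/eqP => -[] /eqP; rewrite oner_eq0. Qed.

HB.instance Definition _ :=
  GRing.Zmodule_isNzRing.Build H quat_mulA quat_mul1l quat_mul1r quat_mulDl quat_mulDr quat_one_neq0.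

End QuatRing.

Section QuatFunctions.
Variable R : realType.
Local Notation H := (quat R).

Definition quat_of_real (x : R) : H := Quat x 0 0 0.
Definition quat_of_complex (z : R[i]) : H :=
  Quat (complex.Re z) (complex.Im z) 0 0.

Definition quat_i : H := Quat 0 1 0 0.

Definition quat_norm (q : H) : R :=
  Num.sqrt (qre q ^+ 2 + qi q ^+ 2 + qj q ^+ 2 + qk q ^+ 2).

Definition vecq (q : H) : H := Quat 0 (qi q) (qj q) (qk q).

Definition Lnq (q : H) : H :=
  if vecq q != 0 then
    quat_of_real (ln (quat_norm q)) +
    quat_of_real (quat_norm (vecq q))^-1 * vecq q
      * quat_of_real (acos (qre q / quat_norm q))
  else
    quat_of_real (ln (quat_norm q)) +
    quat_i * quat_of_real (pi * ((1 - Num.sg (qre q)) / 2)).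

Definition expq_coeff (q : H) (n : nat) : H :=
  quat_of_real (n`!%:R)^-1 * q ^+ n.

(* The sum of the exponential series, taken in each real component. *)
Definition expq (q : H) : H :=
  Quat (limn (series (fun n => qre (expq_coeff q n))))
       (limn (series (fun n => qi (expq_coeff q n))))
       (limn (series (fun n => qj (expq_coeff q n))))
       (limn (series (fun n => qk (expq_coeff q n)))).

End QuatFunctions.

Section QuatMatrix.
Variables (R : realType) (n : nat).
Local Notation H := (quat R).

(* [a + b i + c j + d k = (a + b i) + (c + d i) j] *)
Definition cpart1 (q : H) : R[i] := Complex (qre q) (qi q).
Definition cpart2 (q : H) : R[i] := Complex (qj q) (qk q).

Definition chi (Q : 'M[H]_n) : 'M[R[i]]_(n + n) :=
  block_mx (map_mx cpart1 Q) (map_mx cpart2 Q)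
           (- map_mx (fun q => (cpart2 q)^*%C) Q)
           (map_mx (fun q => (cpart1 q)^*%C) Q).

(* [unitmx] is only available over commutative rings. *)
Definition qinvertible (Q : 'M[H]_n) : Prop :=
  exists P : 'M[H]_n, P *m Q = 1%:M /\ Q *m P = 1%:M.

End QuatMatrix.

Definition principal_submx (K : comNzRingType) (m : nat) (B : 'M[K]_m)
    (L : {set 'I_m}) : 'M[K]_#|L| :=
  mxsub (@enum_val _ (mem L)) (@enum_val _ (mem L)) B.

Definition sum_principal_minors (K : comNzRingType) (m k : nat)
    (B : 'M[K]_m) : K :=
  \sum_(L : {set 'I_m} | #|L| == k) \det (principal_submx B L).

(** * Time scales *)

(* Functions on the time scale [T] are represented by total functions on [R];
   every notion below depends only on their values at points of [T]. *)
Section TimeScale.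
Variable R : realType.
Variable T : set R.
Local Notation H := (quat R).

Definition time_scale : Prop := T !=set0 /\ closed T.

Definition sigma (t : R) : R :=
  if pselect (exists s, T s /\ t < s) then inf [set s | T s /\ t < s]
  else sup T.

Definition rho (t : R) : R :=
  if pselect (exists s, T s /\ s < t) then sup [set s | T s /\ s < t]
  else inf T.

Definition mu (t : R) : R := sigma t - t.

Definition right_dense (t : R) : Prop := sigma t = t.
Definition left_dense (t : R) : Prop := rho t = t.

Definition Tkappa : set R :=
  [set t | T t /\ (has_ubound T -> ~ (rho (sup T) < t /\ t <= sup T))].

Definition is_delta_derive (f : R -> H) (t : R) (d : H) : Prop :=
  forall e : R, 0 < e -> exists2 del : R, 0 < del &
    forall s, T s -> t - del < s -> s < t + del ->
      quat_norm (f (sigma t) - f s - d * quat_of_real (sigma t - s))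
        <= e * `|sigma t - s|.

Definition is_delta_derive_mx (m p : nat) (f : R -> 'M[H]_(m, p)) (t : R)
    (D : 'M[H]_(m, p)) : Prop :=
  forall i j, is_delta_derive (fun s => f s i j) t (D i j).

Definition rd_continuous_real (f : R -> R) : Prop :=
  (forall t, T t -> right_dense t ->
     f x @[x --> within T (nbhs t)] --> f t) /\
  (forall t, T t -> left_dense t ->
     exists l : R, f x @[x --> within [set s | T s /\ s < t] (nbhs t)] --> l).

Definition rd_continuous (f : R -> H) : Prop :=
  [/\ rd_continuous_real (fun t => qre (f t)),
      rd_continuous_real (fun t => qi (f t)),
      rd_continuous_real (fun t => qj (f t)) &
      rd_continuous_real (fun t => qk (f t))].

Definition rd_continuous_mx (m p : nat) (f : R -> 'M[H]_(m, p)) : Prop :=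
  forall i j, rd_continuous (fun t => f t i j).

Definition antiderivative (f F : R -> H) : Prop :=
  forall t, Tkappa t -> is_delta_derive F t (f t).

(* [F s - F r] for an antiderivative [F] of [f] (the value does not depend on
   [F] for [r], [s] in [T]), and [0] if [f] has no antiderivative. *)
Definition delta_int (f : R -> H) (r s : R) : H :=
  xget 0 [set q | exists F, antiderivative f F /\ q = F s - F r].

Definition xi (h : R) (q : H) : H :=
  if h == 0 then q
  else quat_of_real h^-1 * Lnq (1 + q * quat_of_real h).

Definition Eexp (p : R -> H) (t s : R) : H :=
  expq (delta_int (fun tau => xi (mu tau) (p tau)) s t).

Definition regressive (n : nat) (A : R -> 'M[H]_n) : Prop :=
  forall t, Tkappa t -> qinvertible (1%:M + quat_of_real (mu t) *: A t).

Definition rd_regressive (n : nat) (A : R -> 'M[H]_n) : Prop :=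
  rd_continuous_mx A /\ regressive A.

Definition is_solution (n : nat) (A : R -> 'M[H]_n) (phi : R -> 'cV[H]_n) :
    Prop :=
  forall t, Tkappa t -> is_delta_derive_mx phi t (A t *m phi t).

Definition solution_matrix (n : nat) (A : R -> 'M[H]_n) (M : R -> 'M[H]_n) :
    Prop :=
  forall j, is_solution A (fun t => col j (M t)).

Definition wronskian (n : nat) (M : R -> 'M[H]_n) (t : R) : R[i] :=
  \det (chi (M t)).

Definition liouville_coeff (n : nat) (A : R -> 'M[H]_n) (t : R) : R[i] :=
  \sum_(1 <= k < (2 * n).+1)
     (real_complex R (mu t)) ^+ k.-1 * sum_principal_minors k (chi (A t)).

End TimeScale.

(* Main.v *)
(* The Wronskian is real and nonnegative: Gaussian elimination writes every
   quaternion matrix as a product of squares, and [\det (chi (S *m S))] is the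
   square of a real number.  Since [\det (1 + h chi_A)] is the polynomial
   [1 + h (V_1 + h V_2 + ...)] in [h], the increments of a solution matrix give
   [W^Delta = u W] with [u] real and [1 + mu u > 0].  As [u] is bounded on
   compact sets, induction along the time scale shows that [W] vanishes
   identically as soon as it vanishes once.  Otherwise [W > 0] and [ln W] is
   itself an antiderivative of [xi_mu(u)], so no existence theorem for the delta
   integral is needed, only uniqueness of antiderivatives up to a constant. *)

Require Import Defs.
From mathcomp Require Import all_boot all_order all_algebra.
From mathcomp Require Import complex ring lra.
From mathcomp Require Import perm.
From mathcomp Require Import all_classical all_reals all_analysis.

Import Order.TTheory GRing.Theory Num.Theory.
Import numFieldNormedType.Exports.

Set Implicit Arguments.
Unset Strict Implicit.
Unset Printing Implicit Defensive.

Local Open Scope classical_set_scope.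
Local Open Scope ring_scope.

(** * Principal minors and [\det (1 + h X)] *)

(** Nonnegativity of determinants serves twice. Applied to I + mu A, together with invertibility, it
    gives 1 + mu u > 0, so that the principal logarithm carries no i pi term; applied to M, it
    leaves only the cases W = 0 and W > 0. Every estimate runs forward in time. Moving backward
    would mean dividing by the jump factors 1 + mu u; instead, if W is positive at a point, it
    cannot vanish earlier, because a zero propagates forward. In the zero case the factor E_u is
    multiplied by 0 and is never evaluated. For the derivative of W, a product rule for determinants
    would mix values at t and at sigma(t). Instead M(s) is compared with (I + (s - t) A(t)) M(t):
    the determinant of its adjoint is known exactly as a polynomial in s - t, and since M(sigma(t))
    = (I + mu(t) A(t)) M(t), the two matrices differ by exactly the remainder in the definition of
    the delta derivative. This treats right-dense and right-scattered points together. *)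

Section PrincipalMinors.
Variable K : comNzRingType.

(** The map permutes rows and columns alike, so the two signs cancel. The sizes are related by a
    proposition because the lemma is applied with p = [#|L| + #|~: L|], which is not convertible to
    m. *)
Lemma det_mxsub_inj (p m : nat) (f : 'I_p -> 'I_m) (X : 'M[K]_m) :
  p = m -> injective f -> \det (mxsub f f X) = \det X.
Proof.
move=> e; case: m / e f X => f X f_inj.
have -> : mxsub f f X = row_perm (perm f_inj) (col_perm (perm f_inj) X).
  by apply/matrixP => i j; rewrite !mxE !permE.
rewrite row_permE col_permE !det_mulmx !det_perm odd_permV mulrCA -expr2.
by rewrite sqrr_sign mulr1.
Qed.

(* Listing [L] before its complement makes the matrix block upper triangular. *)
Lemma det_rows_id (m : nat) (X : 'M[K]_m) (L : {set 'I_m}) :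
  \det (\matrix_(i, j) (if i \in L then X i j else (i == j)%:R)) =
  \det (principal_submx X L).
Proof.
set N := \matrix_(i, j) _.
pose f (k : 'I_(#|L| + #|~: L|)) : 'I_m :=
  match fintype.split k with
  | inl a => @enum_val _ (mem L) a
  | inr b => @enum_val _ (mem (~: L)) b
  end.
have card_eq : (#|L| + #|~: L|)%N = m by rewrite cardsC card_ord.
have fl a : f (lshift _ a) = enum_val a.
  by rewrite /f -[lshift _ a]/(unsplit (inl a)) unsplitK.
have fr b : f (rshift _ b) = enum_val b.
  by rewrite /f -[rshift _ b]/(unsplit (inr b)) unsplitK.
have inL (a : 'I_#|L|) : (enum_val a \in L) = true := enum_valP a.
have inC (b : 'I_#|~: L|) : (enum_val b \in L) = false.
  by have := enum_valP b; rewrite inE => /negbTE.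
have f_inj : injective f.
  move=> x y; rewrite -(splitK x) -(splitK y).
  case: (fintype.split x) => a; case: (fintype.split y) => b /=; rewrite ?fl ?fr.
  - by move=> /enum_val_inj ->.
  - by move=> e; have := inL a; rewrite e inC.
  - by move=> e; have := inC a; rewrite e inL.
  - by move=> /enum_val_inj ->.
rewrite -(det_mxsub_inj N card_eq f_inj) -[mxsub _ _ _]submxK.
set U := ursubmx _.
have -> : ulsubmx (mxsub f f N) = principal_submx X L.
  by apply/matrixP => i j; rewrite !mxE !fl inL.
have -> : dlsubmx (mxsub f f N) = 0.
  apply/matrixP => i j; rewrite !mxE !fl !fr inC.
  by case: eqP => // e; have := inC i; rewrite e inL.
have -> : drsubmx (mxsub f f N) = 1%:M.
  apply/matrixP => i j; rewrite !mxE !fr inC.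
  by rewrite (inj_eq enum_val_inj).
by rewrite det_ublock det1 mulr1.
Qed.

Lemma principal_submxZ (m : nat) (X : 'M[K]_m) (h : K) (L : {set 'I_m}) :
  \det (principal_submx (h *: X) L) = h ^+ #|L| * \det (principal_submx X L).
Proof. by rewrite -detZ; congr (\det _); apply/matrixP => i j; rewrite !mxE. Qed.

(** Multilinearity in the rows: L collects the rows taken from X, the remaining ones being rows of
    the identity. *)
Lemma det_1addE (m : nat) (X : 'M[K]_m) :
  \det (1%:M + X) = \sum_(L : {set 'I_m}) \det (principal_submx X L).
Proof.
under [RHS]eq_bigr do rewrite -det_rows_id.
rewrite /determinant exchange_big /=; apply: eq_bigr => s _.
rewrite -big_distrr /=; congr (_ * _).
transitivity (\prod_i (X i (s i) + (i == s i)%:R)).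
  by apply: eq_bigr => i _; rewrite !mxE addrC.
rewrite bigA_distr; apply: eq_bigr => L _.
by apply: eq_bigr => i _; rewrite !mxE; case: ifP.
Qed.

(** Grouping the subsets by cardinality k gives h^k V_k; the empty minor yields the 1, and one
    factor h is taken out of the rest. At h = mu and X = chi_A the remaining sum is u. *)
Lemma det_1addZ (m : nat) (X : 'M[K]_m) (h : K) :
  \det (1%:M + h *: X) =
  1 + h * \sum_(1 <= k < m.+1) h ^+ k.-1 * sum_principal_minors k X.
Proof.
rewrite det_1addE.
rewrite (partition_big (fun L : {set 'I_m} => inord #|L| : 'I_m.+1) predT) //=.
transitivity (\sum_(0 <= k < m.+1) h ^+ k * sum_principal_minors k X).
  rewrite big_mkord; apply: eq_bigr => k _.
  rewrite /sum_principal_minors big_distrr /=.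
  have P (L : {set 'I_m}) : (inord #|L| == k :> 'I_m.+1) = (#|L| == k).
    rewrite -val_eqE /= inordK // ltnS.
    by rewrite (leq_trans (max_card _)) // card_ord.
  rewrite (eq_bigl _ _ P); apply: eq_bigr => L /eqP <-.
  exact: principal_submxZ.
rewrite [LHS]big_ltn // expr0 mul1r; congr (_ + _).
  rewrite /sum_principal_minors (big_pred1 finset.set0); last first.
    by move=> L; rewrite cards_eq0.
  move: (principal_submx X finset.set0); rewrite cards0 => Y.
  exact: det_mx00.
rewrite big_distrr /= !big_nat; apply: eq_bigr => -[//|k] _ /=.
by rewrite exprS mulrA.
Qed.

End PrincipalMinors.

(** * The complex adjoint matrix *)

Section ComplexAdjoint.
Variable R : realType.
Local Notation H := (quat R).
Local Notation C := R[i].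

Lemma quatP (p q : H) :
  qre p = qre q -> qi p = qi q -> qj p = qj q -> qk p = qk q -> p = q.
Proof. by case: p => a b c d; case: q => a' b' c' d' /= -> -> -> ->. Qed.

Lemma cpart1D (p q : H) : cpart1 (p + q) = cpart1 p + cpart1 q.
Proof. by []. Qed.
Lemma cpart2D (p q : H) : cpart2 (p + q) = cpart2 p + cpart2 q.
Proof. by []. Qed.

Lemma cpart1_sum I r (P : pred I) (F : I -> H) :
  cpart1 (\sum_(i <- r | P i) F i) = \sum_(i <- r | P i) cpart1 (F i).
Proof. exact: (big_morph (@cpart1 R) cpart1D erefl). Qed.
Lemma cpart2_sum I r (P : pred I) (F : I -> H) :
  cpart2 (\sum_(i <- r | P i) F i) = \sum_(i <- r | P i) cpart2 (F i).
Proof. exact: (big_morph (@cpart2 R) cpart2D erefl). Qed.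

Lemma chiM n (P Q : 'M[H]_n) : chi (P *m Q) = chi P *m chi Q.
Proof.
rewrite /chi mulmx_block; congr block_mx; apply/matrixP => i j;
  rewrite !mxE ?cpart1_sum ?cpart2_sum -big_split /= ?rmorph_sum -?sumrN;
  apply: eq_bigr => k _; rewrite !mxE; apply/eqP;
  by rewrite eq_complex /=; apply/andP; split; apply/eqP; ring.
Qed.

Lemma chi1 n : chi (1%:M : 'M[H]_n) = 1%:M.
Proof.
rewrite /chi scalar_mx_block; congr block_mx; apply/matrixP => i j;
  by rewrite !mxE; case: (i == j) => //=; apply/eqP; rewrite eq_complex /= ?oppr0 !eqxx.
Qed.

Lemma chiD n (P Q : 'M[H]_n) : chi (P + Q) = chi P + chi Q.
Proof.
rewrite /chi add_block_mx; congr block_mx; apply/matrixP => i j; rewrite !mxE //.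
- by rewrite cpart2D rmorphD opprD.
- by rewrite cpart1D rmorphD.
Qed.

Lemma chiZ n (h : R) (Q : 'M[H]_n) :
  chi (quat_of_real h *: Q) = h%:C%C *: chi Q.
Proof.
rewrite /chi scale_block_mx; congr block_mx; apply/matrixP => i j; rewrite !mxE;
  apply/eqP; rewrite eq_complex /=; apply/andP; split; apply/eqP; ring.
Qed.

(** The symplectic matrix J, with inverse -J, conjugates chi(Q) into its entrywise complex
    conjugate. *)
Lemma det_chi_conj n (Q : 'M[H]_n) : (\det (chi Q))^*%C = \det (chi Q).
Proof.
pose J : 'M[C]_(n + n) := block_mx 0 1%:M (- 1%:M) 0.
have eJ : J *m chi Q = map_mx (@conjc R) (chi Q) *m J.
  rewrite /J /chi map_block_mx !mulmx_block !mul0mx !mulmx0 !mul1mx !mulmx1.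
  rewrite !add0r !addr0 !mulNmx !mulmxN !mul1mx !mulmx1.
  by congr block_mx; apply/matrixP => i j; rewrite !mxE; apply/eqP;
    rewrite eq_complex /= ?opprK !eqxx.
have J2 : J *m (- J) = 1%:M.
  rewrite /J opp_block_mx mulmx_block !(mul0mx, oppr0, mulmx0, mulmx1, mul1mx).
  by rewrite !(addr0, add0r, mulNmx, mulmxN, mulmx1, opprK) -scalar_mx_block.
have J0 : \det J != 0.
  apply/eqP => J0; move: (congr1 determinant J2); rewrite det_mulmx J0 mul0r det1.
  by move/eqP; rewrite eq_sym oner_eq0.
have := congr1 determinant eJ.
by rewrite !det_mulmx det_map_mx mulrC => /(mulIf J0) <-.
Qed.

Lemma det_chi_real n (Q : 'M[H]_n) :
  \det (chi Q) = (complex.Re (\det (chi Q)))%:C%C.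
Proof.
have := det_chi_conj Q; case: (\det (chi Q)) => a b /= [] eb.
have -> : b = 0 by lra.
by [].
Qed.

(** Half-angle formula: with N = |q| and a = Re q, a root is (N + q) / sqrt(2 (N + a)). The
    denominator vanishes only when q is a nonpositive real, which is the square of sqrt(-q) i. *)
Lemma quat_sqrt (q : H) : exists p : H, p * p = q.
Proof.
case: q => a b c d.
pose N := Num.sqrt (a ^+ 2 + b ^+ 2 + c ^+ 2 + d ^+ 2).
have s0 : 0 <= a ^+ 2 + b ^+ 2 + c ^+ 2 + d ^+ 2 by rewrite !addr_ge0 ?sqr_ge0.
have N2 : N ^+ 2 = a ^+ 2 + b ^+ 2 + c ^+ 2 + d ^+ 2 by rewrite sqr_sqrtr.
have N0 : 0 <= N by rewrite sqrtr_ge0.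
have [Na|Na] := ltP 0 (N + a).
  set r := Num.sqrt (2 * (N + a)).
  have r0 : r != 0 by rewrite gt_eqF // sqrtr_gt0 mulr_gt0.
  have r2 : r ^+ 2 = 2 * (N + a) by rewrite sqr_sqrtr // mulr_ge0 // ltW.
  have h x : x = x * (2 * (N + a)) / r ^+ 2 by rewrite -r2 mulfK // expf_neq0.
  have ha : a * (2 * (N + a)) = (N + a) ^+ 2 - b ^+ 2 - c ^+ 2 - d ^+ 2.
    by rewrite sqrrD N2; ring.
  exists (Quat ((N + a) / r) (b / r) (c / r) (d / r)).
  by apply: quatP => /=; rewrite [RHS]h ?ha; field.
have le2 : N ^+ 2 <= a ^+ 2.
  by rewrite -[a ^+ 2]sqrrN ler_sqr ?nnegrE //; lra.
have := sqr_ge0 b; have := sqr_ge0 c; have := sqr_ge0 d => d2 c2 b2.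
have b0 : b = 0 by apply/eqP; rewrite -sqrf_eq0; apply/eqP; lra.
have c0 : c = 0 by apply/eqP; rewrite -sqrf_eq0; apply/eqP; lra.
have d0 : d = 0 by apply/eqP; rewrite -sqrf_eq0; apply/eqP; lra.
have ea : Num.sqrt (- a) * Num.sqrt (- a) = - a by rewrite -expr2 sqr_sqrtr //; lra.
exists (Quat 0 (Num.sqrt (- a)) 0 0); apply: quatP => /=;
  rewrite ?ea ?b0 ?c0 ?d0; ring.
Qed.

Lemma det_chi_sqr n (S : 'M[H]_n) : 0 <= \det (chi (S *m S)).
Proof.
rewrite chiM det_mulmx det_chi_real -expr2 -rmorphXn /=.
by rewrite lecR sqr_ge0.
Qed.

End ComplexAdjoint.

(** * Factorisation of quaternion matrices into squares *)

Section ProductsOfSquares.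
Variable R : realType.
Local Notation H := (quat R).

Inductive square_product n : 'M[H]_n -> Prop :=
| square_product1 : square_product 1%:M
| square_productM S Q : square_product Q -> square_product (S *m S *m Q).

Lemma square_product_sqr n (S : 'M[H]_n) : square_product (S *m S).
Proof.
by rewrite -[S *m S]mulmx1; exact: square_productM (square_product1 n).
Qed.

Lemma square_product_mul n (P Q : 'M[H]_n) :
  square_product P -> square_product Q -> square_product (P *m Q).
Proof.
move=> hP hQ; elim: hP => [|S P' _ IH]; first by rewrite mul1mx.
by rewrite -mulmxA; exact: square_productM.
Qed.

Lemma square_product_lift n (Q : 'M[H]_n) : square_product Q ->
  square_product (block_mx 1%:M 0 0 Q : 'M[H]_(1 + n)).
Proof.
elim=> [|S P _ IH]; first by rewrite -scalar_mx_block; exact: square_product1.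
have -> : block_mx 1%:M 0 0 (S *m S *m P) =
    block_mx 1%:M 0 0 S *m block_mx 1%:M 0 0 S *m block_mx 1%:M 0 0 P
    :> 'M[H]_(1 + n).
  by rewrite !mulmx_block !(mul0mx, mulmx0, mulmx1, addr0, add0r).
exact: square_productM.
Qed.

(** Transvections multiply by adding their off-diagonal blocks, so halving the block gives a square
    root. *)
Lemma half_mx m p (X : 'M[H]_(m, p)) : exists Y, Y + Y = X.
Proof.
exists (quat_of_real 2^-1 *: X); rewrite -scalerDl -[RHS]scale1r.
by congr (_ *: _); apply: quatP => /=; field.
Qed.

Lemma square_product_utransvection m n (X : 'M[H]_(m, n)) :
  square_product (block_mx 1%:M X 0 1%:M : 'M[H]_(m + n)).
Proof.
have [Y <-] := half_mx X.
have -> : block_mx 1%:M (Y + Y) 0 1%:M =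
    block_mx 1%:M Y 0 1%:M *m block_mx 1%:M Y 0 1%:M :> 'M[H]_(m + n).
  by rewrite mulmx_block !(mul0mx, mulmx0, mul1mx, mulmx1, addr0, add0r).
exact: square_product_sqr.
Qed.

Lemma square_product_ltransvection m n (X : 'M[H]_(n, m)) :
  square_product (block_mx 1%:M 0 X 1%:M : 'M[H]_(m + n)).
Proof.
have [Y <-] := half_mx X.
have -> : block_mx 1%:M 0 (Y + Y) 1%:M =
    block_mx 1%:M 0 Y 1%:M *m block_mx 1%:M 0 Y 1%:M :> 'M[H]_(m + n).
  by rewrite mulmx_block !(mul0mx, mulmx0, mul1mx, mulmx1, addr0, add0r).
exact: square_product_sqr.
Qed.

Lemma square_product_scalar_block n (q : H) :
  square_product (block_mx q%:M 0 0 1%:M : 'M[H]_(1 + n)).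
Proof.
have [p <-] := quat_sqrt q.
have -> : block_mx (p * p)%:M 0 0 1%:M =
    block_mx p%:M 0 0 1%:M *m block_mx p%:M 0 0 1%:M :> 'M[H]_(1 + n).
  rewrite mulmx_block !(mul0mx, mulmx0, mul1mx, mulmx1, addr0, add0r).
  by rewrite scalar_mxM.
exact: square_product_sqr.
Qed.

Lemma quat_inv (q : H) : q != 0 -> exists p : H, p * q = 1 /\ q * p = 1.
Proof.
case: q => a b c d q0.
pose N := a ^+ 2 + b ^+ 2 + c ^+ 2 + d ^+ 2.
have N0 : N != 0.
  apply: contra q0; rewrite /N !paddr_eq0 ?addr_ge0 ?sqr_ge0 // !sqrf_eq0.
  by move=> /andP[/andP[/andP[/eqP-> /eqP->] /eqP->] /eqP->].
exists (Quat (a / N) (- b / N) (- c / N) (- d / N)).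
by split; apply: quatP => /=; rewrite /N in N0 *; field.
Qed.

(** Block LDU factorisation with Schur complement d - c p b, where p inverts the pivot. The outer
    factors are transvections, the pivot has a quaternion square root, and the Schur complement
    falls under [IH]. *)
Lemma square_product_pivot n (a : 'M[H]_1) b c d : a 0 0 != 0 ->
  (forall Q : 'M[H]_n, square_product Q) ->
  square_product (block_mx a b c d : 'M[H]_(1 + n)).
Proof.
move=> /quat_inv[p [pa ap]] IH.
have eA : a = (a 0 0)%:M by rewrite [LHS]mx11_scalar.
have apM : a *m p%:M = 1%:M by rewrite eA -scalar_mxM ap.
have paM : p%:M *m a = 1%:M by rewrite eA -scalar_mxM pa.
have -> : block_mx a b c d =
    block_mx 1%:M 0 (c *m p%:M) 1%:M *m block_mx a 0 0 1%:M *m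
    block_mx 1%:M 0 0 (d - c *m p%:M *m b) *m block_mx 1%:M (p%:M *m b) 0 1%:M
    :> 'M[H]_(1 + n).
  rewrite !mulmx_block !(mul0mx, mulmx0, mul1mx, mulmx1, addr0, add0r).
  rewrite -!mulmxA paM mulmx1 !mulmxA apM mul1mx -!mulmxA [a *m _]mulmxA.
  by rewrite apM mul1mx addrC subrK.
apply: square_product_mul; last exact: square_product_utransvection.
apply: square_product_mul; last by apply: square_product_lift; exact: IH.
apply: square_product_mul; first exact: square_product_ltransvection.
by rewrite eA; exact: square_product_scalar_block.
Qed.

Lemma square_product_all n (Q : 'M[H]_n) : square_product Q.
Proof.
elim: n Q => [|n IH] Q.
  have -> : Q = 1%:M by apply/matrixP => -[].
  exact: square_product1.
rewrite -[Q](@submxK _ 1 n 1 n).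
set a := ulsubmx _; set b := ursubmx _; set c := dlsubmx _; set d := drsubmx _.
have [a0|a0] := eqVneq (a 0 0) 0; last exact: square_product_pivot.
have aE : a = 0 by rewrite [a]mx11_scalar a0 raddf0.
have [c0|c0] := eqVneq c 0.
  (* A zero column is the value of a pivoted matrix at a zero pivot. *)
  have -> : block_mx a b c d =
      block_mx 1%:M b 0 d *m block_mx 0%:M 0 0 1%:M :> 'M[H]_(1 + n).
    rewrite mulmx_block aE c0.
    by rewrite !(mul0mx, mulmx0, mul1mx, mulmx1, addr0, add0r) raddf0.
  apply: square_product_mul; last exact: square_product_scalar_block.
  by apply: square_product_pivot => //; rewrite mxE oner_eq0.
have [i ci] : exists i, c i 0 != 0.
  apply: contrapT => h; case/eqP: c0; apply/matrixP => i j.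
  rewrite (ord1 j) [RHS]mxE; case: (eqVneq (c i 0) 0) => [->|ci] //.
  by case: h; exists i.
(* Adding row i of the lower block to the first row brings the nonzero entry [c i 0] to the pivot
   position. *)
have -> : block_mx a b c d =
    block_mx 1%:M (- delta_mx 0 i) 0 1%:M *m
    block_mx (a + delta_mx 0 i *m c) (b + delta_mx 0 i *m d) c d :> 'M[H]_(1 + n).
  rewrite mulmx_block !(mul0mx, mulmx0, mul1mx, mulmx1, addr0, add0r).
  by rewrite !mulNmx !addrK.
apply: square_product_mul.
  exact: (square_product_utransvection (- delta_mx 0 i : 'M[H]_(1, n))).
apply: square_product_pivot => //.
by rewrite aE add0r -rowE mxE.
Qed.

Lemma det_chi_ge0 n (Q : 'M[H]_n) : 0 <= complex.Re (\det (chi Q)).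
Proof.
rewrite -(@lecR R) -det_chi_real.
elim: (square_product_all Q) => [|S P _ IH]; first by rewrite chi1 det1 ler01.
by rewrite chiM det_mulmx mulr_ge0 // det_chi_sqr.
Qed.

Lemma det_chi_gt0 n (Q : 'M[H]_n) :
  qinvertible Q -> 0 < complex.Re (\det (chi Q)).
Proof.
move=> [P [PQ _]]; rewrite lt_neqAle det_chi_ge0 andbT; apply/eqP => Q0.
have := congr1 (fun X => \det (chi X)) PQ.
rewrite /= chiM chi1 det_mulmx det1 (det_chi_real Q) -Q0 mulr0.
by move/eqP; rewrite eq_sym oner_eq0.
Qed.

End ProductsOfSquares.

(** * Induction on time scales *)

Section TimeScaleOrder.
Variables (R : realType) (T : set R) (hT : time_scale T).

Lemma time_scale_adherent x :
  (forall e, 0 < e -> exists2 s, T s & `|s - x| < e) -> T x.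
Proof.
case: hT => _ cT h; apply: cT => U /nbhs_ballP[e /= e0 eU].
have [s Ts sx] := h _ e0; exists s; split => //.
by apply: eU; rewrite /ball /= distrC.
Qed.

Lemma time_scale_sup (S : set R) : S `<=` T -> has_sup S -> T (sup S).
Proof.
move=> ST hS; apply: time_scale_adherent => e e0.
have [s Ss es] := sup_adherent e0 hS; exists s; first exact: ST.
have := ub_le_sup hS.2 Ss; rewrite ltr_distlC => ?; apply/andP; split; lra.
Qed.

Lemma time_scale_inf (S : set R) : S `<=` T -> has_inf S -> T (inf S).
Proof.
move=> ST hS; apply: time_scale_adherent => e e0.
have [s Ss es] := inf_adherent e0 hS; exists s; first exact: ST.
have := ge_inf hS.2 Ss; rewrite ltr_distlC => ?; apply/andP; split; lra.
Qed.

Lemma sigma_spec t s : T s -> t < s ->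
  [/\ T (sigma T t), t <= sigma T t & sigma T t <= s].
Proof.
move=> Ts ts; rewrite /sigma; case: pselect => /= [_|[]]; last by exists s.
have lb : lbound [set s | T s /\ t < s] t by move=> r [_ /ltW].
have hi : has_inf [set s | T s /\ t < s] by split; [exists s | exists t].
split; first by apply: time_scale_inf hi => r [].
- by apply: lb_le_inf => //; exists s.
- by apply: ge_inf; [exists t | split].
Qed.

(** Here the convention for the infimum of the empty set takes effect: a maximum of [T] counts as
    right-dense. *)
Lemma sigma_max t : T t -> (forall s, T s -> s <= t) -> sigma T t = t.
Proof.
move=> Tt h; rewrite /sigma; case: pselect => /= [[s [Ts ts]]|_].
  by have := h s Ts; rewrite leNgt ts.
apply/eqP; rewrite eq_le; apply/andP; split.
- by apply: ge_sup => //; exists t.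
- by apply: ub_le_sup Tt; exists t.
Qed.

Lemma sigma_ge t : T t -> t <= sigma T t.
Proof.
move=> Tt; have [[s [Ts ts]]|h] := pselect (exists s, T s /\ t < s).
  by have [] := sigma_spec Ts ts.
rewrite sigma_max // => s Ts; rewrite leNgt; apply/negP => ts; apply: h.
by exists s.
Qed.

Lemma sigma_mem t : T t -> T (sigma T t).
Proof.
move=> Tt; have [[s [Ts ts]]|h] := pselect (exists s, T s /\ t < s).
  by have [] := sigma_spec Ts ts.
rewrite sigma_max // => s Ts; rewrite leNgt; apply/negP => ts; apply: h.
by exists s.
Qed.

Lemma right_dense_near t s d : T s -> t < s -> right_dense T t -> 0 < d ->
  exists r, [/\ T r, t < r & r < t + d].
Proof.
move=> Ts ts; rewrite /right_dense /sigma; case: pselect => /= [_|[]]; last by exists s.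
move=> it d0.
have hi : has_inf [set s | T s /\ t < s].
  by split; [exists s | exists t => r [_ /ltW]].
have [r [Tr tr]] := inf_adherent d0 hi; rewrite it => rd.
by exists r.
Qed.

(** Stronger than [left_dense], which by the convention for the empty supremum also holds at a
    minimum of [T]. *)
Definition left_limit t := forall d, 0 < d -> exists s, [/\ T s, t - d < s & s < t].

Lemma left_limit_dense t : left_limit t -> left_dense T t.
Proof.
move=> h; rewrite /left_dense /rho; case: pselect => /= [_|[]]; last first.
  by have [s [Ts _ st]] := h _ ltr01; exists s.
apply/eqP; rewrite eq_le; apply/andP; split.
  apply: ge_sup => [|r [_ /ltW]//].
  by have [s [Ts _ st]] := h _ ltr01; exists s.
rewrite leNgt; apply/negP; rewrite -subr_gt0 => /h [s [Ts]].
rewrite opprB addrC subrK => lts st.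
have : s <= sup [set s | T s /\ s < t].
  by apply: ub_le_sup; [exists t => r [_ /ltW] | split].
by rewrite leNgt lts.
Qed.

(** A point t with a later point of [T] competes in the supremum defining [rho T (sup T)], hence is
    not beyond it. *)
Lemma Tkappa_lt t s : T t -> T s -> t < s -> Tkappa T t.
Proof.
move=> Tt Ts ts; split=> // ub [rt _].
have st : t < sup T by apply: lt_le_trans ts _; exact: ub_le_sup.
suff : t <= rho T (sup T) by rewrite leNgt rt.
rewrite /rho; case: pselect => /= [_|[]]; last by exists t.
by apply: ub_le_sup; [exists (sup T) => r [_ /ltW] | split].
Qed.

Lemma Tkappa_left_limit t : T t -> left_limit t -> Tkappa T t.
Proof.
move=> Tt lt; split=> // ub [rt].
have hs : has_sup T by split=> //; exists t.
rewrite le_eqVlt => /orP[/eqP et|ts].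
  by move: rt; rewrite -et (left_limit_dense lt) ltxx.
have [] := Tkappa_lt Tt (time_scale_sup (@subset_refl _ T) hs) ts.
by move=> _ /(_ ub); apply; split => //; exact: ltW.
Qed.

(** Let c be the supremum of the points up to which P holds throughout. Closedness puts c in [T],
    the left-limit clause gives P at c, and if c < b the jump clause or the right-dense clause
    pushes past c, a contradiction. *)
Lemma time_scale_induction (P : R -> Prop) (a b : R) : T a -> T b -> a <= b ->
  P a ->
  (forall t, T t -> a <= t -> t < b -> t < sigma T t -> P t -> P (sigma T t)) ->
  (forall t, T t -> a <= t -> t < b -> right_dense T t -> P t ->
     exists2 d, 0 < d & forall s, T s -> t < s -> s < t + d -> s <= b -> P s) ->
  (forall t, T t -> a < t -> t <= b -> left_limit t ->
     (forall s, T s -> a <= s -> s < t -> P s) -> P t) ->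
  P b.
Proof.
move=> Ta Tb ab Pa Ps Pd Pl.
pose S := [set s | [/\ T s, a <= s, s <= b &
                     forall r, T r -> a <= r -> r <= s -> P r]].
have Sa : S a.
  split=> // r _ ar ra; suff -> : r = a by [].
  by apply/eqP; rewrite eq_le ra ar.
have ubS : ubound S b by move=> s [].
have hS : has_sup S by split; [exists a | exists b].
pose c := sup S.
have Tc : T c by apply: time_scale_sup hS => s [].
have ac : a <= c by apply: ub_le_sup Sa; exists b.
have cb : c <= b by apply: ge_sup => //; exists a.
have Plt r : T r -> a <= r -> r < c -> P r.
  move=> Tr ar; rewrite -subr_gt0 => /sup_adherent /(_ hS) [s [_ _ _ Hs]].
  by rewrite -/c opprB addrC subrK => /ltW; exact: Hs.
have Pc : P c.
  have [lc|nlc] := pselect (left_limit c).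
    have [ac'|] := ltP a c; first exact: Pl.
    by move=> ca; suff -> : c = a by []; apply/eqP; rewrite eq_le ca ac.
  (* When [T] leaves a gap below c, an element of [S] close enough to c must be c itself. *)
  have [d d0 hd] : exists2 d, 0 < d & forall s, T s -> c - d < s -> c <= s.
    apply: contrapT => h; apply: nlc => d d0; apply: contrapT => h'; apply: h.
    exists d => // s Ts ds; rewrite leNgt; apply/negP => sc; apply: h'.
    by exists s.
  have [s Ss cs] := sup_adherent d0 hS.
  have sc : s <= c by apply: ub_le_sup Ss; exists b.
  case: Ss => Ts as_ sb Hs; apply: Hs => //; exact: hd.
have Ple r : T r -> a <= r -> r <= c -> P r.
  by move=> Tr ar; rewrite le_eqVlt => /orP[/eqP-> //|]; exact: Plt.
have Sc s : S s -> s <= c by move=> Ss; apply: ub_le_sup Ss; exists b.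
move: cb; rewrite le_eqVlt => /orP[/eqP<- //|cb].
have [Tsc csc scb] := sigma_spec Tb cb.
move: (csc); rewrite le_eqVlt => /orP[/eqP esc|ltsc].
  have [d d0 Hd] := Pd c Tc ac cb (esym esc) Pc.
  have [r [Tr cr rd]] : exists r, [/\ T r, c < r & r < c + Num.min d (b - c)].
    by apply: (right_dense_near Tb cb (esym esc)); rewrite lt_min d0 subr_gt0.
  have rd' : r < c + d.
    by apply: lt_le_trans rd _; rewrite lerD2l ge_min lexx.
  have rb : r <= b.
    apply: ltW; apply: lt_le_trans rd _.
    by rewrite -lerBrDl ge_min lexx orbT.
  suff /Sc : S r by rewrite leNgt cr.
  split=> //; first exact: le_trans ac (ltW cr).
  move=> q Tq aq qr; have [qc|cq] := leP q c; first exact: Ple.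
  apply: Hd => //; [exact: le_lt_trans qr rd' | exact: le_trans qr rb].
suff /Sc : S (sigma T c) by rewrite leNgt ltsc.
split=> //; first exact: le_trans ac csc.
move=> q Tq aq qs; have [qc|cq] := leP q c; first exact: Ple.
suff -> : q = sigma T c by apply: Ps.
by apply/eqP; rewrite eq_le qs; have [_ _ ->] := sigma_spec Tq cq.
Qed.

End TimeScaleOrder.

(** * Real delta derivatives and linear equations *)

Section RealDeltaDerivative.
Variables (R : realType) (T : set R) (hT : time_scale T).
Implicit Types (f v w : R -> R) (a b t d C : R).

Definition real_delta_derive f t d := forall e, 0 < e ->
  exists2 del, 0 < del & forall s, T s -> t - del < s -> s < t + del ->
    `|f (sigma T t) - f s - d * (sigma T t - s)| <= e * `|sigma T t - s|.

Definition ts_continuous_at f t := forall e, 0 < e ->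
  exists2 del, 0 < del & forall s, T s -> t - del < s -> s < t + del ->
    `|f s - f t| < e.

Lemma near_lt t s del : t - del < s -> s < t + del -> `|s - t| < del.
Proof. by move=> *; rewrite ltr_distl; apply/andP; split; lra. Qed.

Lemma mu_ge0 t : T t -> 0 <= mu T t.
Proof. by move=> Tt; rewrite subr_ge0 sigma_ge. Qed.

(** Dividing by m + 1 covers m = 0; the same device recurs in the choices of tolerances and radii
    below. *)
Lemma eq0_small (x m : R) : 0 <= m -> (forall e, 0 < e -> `|x| <= e * m) -> x = 0.
Proof.
move=> m0 h; apply/eqP; rewrite -normr_le0; apply/ler_addgt0Pl => e e0.
have m1 : 0 < m + 1 by lra.
have := h (e / (m + 1)) (divr_gt0 e0 m1).
move/le_trans; apply; rewrite addr0 mulrAC ler_pdivrMr //.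
by rewrite ler_wpM2l ?ltW // ltrDl.
Qed.

(** The defining inequality taken at s = t bounds the discrepancy by e mu(t) for every e > 0. *)
Lemma delta_derive_jump f t d : T t -> real_delta_derive f t d ->
  f (sigma T t) = f t + d * mu T t.
Proof.
move=> Tt df; apply/eqP; rewrite -subr_eq0; apply/eqP.
apply: (eq0_small (mu_ge0 Tt)) => e e0; have [del del0 h] := df e e0.
have := h t Tt; rewrite opprD addrA -/(mu T t) [`|mu T t|]ger0_norm ?mu_ge0 //.
by apply; lra.
Qed.

(** By the jump formula, f s - f t is d (s - t) minus the derivative remainder; near t the latter is
    at most [e1] (mu + 1) = e / 2. *)
Lemma delta_derive_continuous f t d : T t -> real_delta_derive f t d ->
  ts_continuous_at f t.
Proof.
move=> Tt df e e0; have m0 := mu_ge0 Tt.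
pose e1 := e / 2 / (mu T t + 1).
have e10 : 0 < e1 by rewrite !divr_gt0 //; lra.
have eE : e1 * (mu T t + 1) = e / 2 by rewrite divfK //; lra.
have [del del0 h] := df _ e10; have nd := normr_ge0 d.
pose r := e / 2 / (`|d| + 1).
have r0 : 0 < r by rewrite !divr_gt0 //; lra.
have rE : (`|d| + 1) * r = e / 2 by rewrite mulrC divfK //; lra.
exists (Num.min del (Num.min 1 r)) => [|s Ts s1 s2].
  by rewrite !lt_min del0 ltr01.
have := near_lt s1 s2; rewrite !lt_min => /and3P[sd s1' sr].
have hs : `|f (sigma T t) - f s - d * (sigma T t - s)| <= e1 * `|sigma T t - s|.
  by apply: h => //; move: sd; rewrite ltr_distl => /andP[]; lra.
move: hs; rewrite (delta_derive_jump Tt df) => hs.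
have -> : f s - f t = - (f t + d * mu T t - f s - d * (sigma T t - s)) + d * (s - t).
  by rewrite /mu; ring.
apply: le_lt_trans (ler_normD _ _) _; rewrite normrN normrM.
have b1 : `|sigma T t - s| <= mu T t + 1.
  rewrite -(subrK t (sigma T t)) -addrA; apply: le_trans (ler_normD _ _) _.
  by rewrite -/(mu T t) ger0_norm // lerD2l distrC ltW.
have b2 : `|d| * `|s - t| <= `|d| * r by rewrite ler_wpM2l // ltW.
have b3 : e1 * `|sigma T t - s| <= e / 2 by rewrite -eE ler_wpM2l // ltW.
rewrite mulrDl mul1r in rE; lra.
Qed.

Lemma delta_derive_right_dense f t d : right_dense T t -> real_delta_derive f t d ->
  forall e, 0 < e -> exists2 del, 0 < del &
    forall s, T s -> t - del < s -> s < t + del ->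
      `|f s - f t - d * (s - t)| <= e * `|s - t|.
Proof.
move=> rt df e e0; have [del del0 h] := df e e0; exists del => // s Ts s1 s2.
have := h s Ts s1 s2; rewrite rt => hs.
have -> : f s - f t - d * (s - t) = - (f t - f s - d * (t - s)) by ring.
by rewrite normrN [`|s - t|]distrC.
Qed.

Lemma left_approximation f a t e : left_limit T t -> ts_continuous_at f t ->
  a < t -> 0 < e -> exists s, [/\ T s, a <= s, s < t & `|f s - f t| < e].
Proof.
move=> lt cf at_ e0; have [del del0 h] := cf e e0.
have d0 : 0 < Num.min del (t - a) by rewrite lt_min del0 subr_gt0.
have [s [Ts ds st]] := lt _ d0; exists s.
have m1 : Num.min del (t - a) <= del by rewrite ge_min lexx.
have m2 : Num.min del (t - a) <= t - a by rewrite ge_min lexx orbT.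
by split => //; [lra | apply: h => //; lra].
Qed.

Lemma left_limit_le f a t c : left_limit T t -> ts_continuous_at f t ->
  a < t -> (forall s, T s -> a <= s -> s < t -> f s <= c) -> f t <= c.
Proof.
move=> lt cf at_ h; rewrite leNgt; apply/negP; rewrite -subr_gt0 => e0.
have [s [Ts as_ st]] := left_approximation lt cf at_ e0.
by rewrite ltr_distl => /andP[hs _]; have := h s Ts as_ st; lra.
Qed.

Lemma ts_continuousN f t : ts_continuous_at f t -> ts_continuous_at (fun s => - f s) t.
Proof.
move=> cf e e0; have [del del0 h] := cf e e0; exists del => // s Ts s1 s2.
by rewrite -opprD normrN; exact: h.
Qed.

Lemma left_limit_ge f a t c : left_limit T t -> ts_continuous_at f t ->
  a < t -> (forall s, T s -> a <= s -> s < t -> c <= f s) -> c <= f t.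
Proof.
move=> lt cf at_ h; rewrite -lerN2.
apply: (left_limit_le lt (ts_continuousN cf) at_) => s Ts as_ st.
by rewrite lerN2; exact: h.
Qed.

Lemma left_limit_norm_le f a t c g : left_limit T t -> ts_continuous_at f t ->
  a < t -> (forall s, T s -> a <= s -> s < t -> `|f s - c| <= g) -> `|f t - c| <= g.
Proof.
move=> lt cf at_ h; rewrite ler_distl; apply/andP; split.
  apply: (left_limit_ge lt cf at_) => s Ts as_ st.
  by have := h s Ts as_ st; rewrite ler_distl => /andP[].
apply: (left_limit_le lt cf at_) => s Ts as_ st.
by have := h s Ts as_ st; rewrite ler_distl => /andP[].
Qed.

(** In place of a mean value theorem, the bound |f t - f a| <= e (t - a) is propagated along [T] for
    each e > 0. *)
Lemma delta_derive0_constant_le f a b : T a -> T b -> a <= b ->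
  (forall t, Tkappa T t -> real_delta_derive f t 0) -> f b = f a.
Proof.
move=> Ta Tb ab df; apply/eqP; rewrite -subr_eq0; apply/eqP.
have ab0 : 0 <= b - a by rewrite subr_ge0.
apply: (eq0_small ab0) => e e0.
apply: (time_scale_induction hT (P := fun t => `|f t - f a| <= e * (t - a)) Ta Tb ab).
- by rewrite !subrr normr0 mulr0.
- move=> t Tt at_ tb ts Pt; have Kt := Tkappa_lt Tt Tb tb.
  rewrite (delta_derive_jump Tt (df t Kt)) mul0r addr0; apply: le_trans Pt _.
  by rewrite ler_wpM2l ?ltW //; lra.
- move=> t Tt at_ tb rt Pt; have Kt := Tkappa_lt Tt Tb tb.
  have [del del0 h] := delta_derive_right_dense rt (df t Kt) e0.
  exists del => // s Ts ts std sb; have h1 : t - del < s by lra.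
  have := h s Ts h1 std; rewrite mul0r subr0 (@ger0_norm _ (s - t)); last lra.
  move=> hs; have -> : f s - f a = (f s - f t) + (f t - f a) by ring.
  apply: le_trans (ler_normD _ _) _; lra.
- move=> t Tt at_ tb lt Pt; have Kt := Tkappa_left_limit hT Tt lt.
  apply: (left_limit_norm_le lt (delta_derive_continuous Tt (df t Kt)) at_).
  move=> s Ts as_ st; apply: le_trans (Pt s Ts as_ st) _.
  by rewrite ler_wpM2l ?ltW //; lra.
Qed.

Lemma delta_derive0_constant f a b : T a -> T b ->
  (forall t, Tkappa T t -> real_delta_derive f t 0) -> f b = f a.
Proof.
move=> Ta Tb df; have [ab|/ltW ba] := leP a b.
  exact: delta_derive0_constant_le.
by apply/esym; exact: delta_derive0_constant_le.
Qed.

(** A Gronwall argument: |w t| <= e exp((C + 1)(t - a)) is propagated for each e > 0. A step of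
    length h multiplies the bound by at least 1 + (C + 1) h; C accounts for v, and the extra 1
    absorbs the derivative error e h at right-dense points. *)
Lemma linear_zero_forward v w a b C : T a -> T b -> a <= b -> 0 < C ->
  (forall t, Tkappa T t -> real_delta_derive w t (v t * w t)) ->
  (forall t, T t -> a <= t -> t < b -> `|v t| <= C) ->
  w a = 0 -> w b = 0.
Proof.
move=> Ta Tb ab C0 dw vC wa; pose B t := expR ((C + 1) * (t - a)).
have B0 : 0 <= B b by exact: expR_ge0.
have Bh t h : B t * (1 + (C + 1) * h) <= B (t + h).
  have e : (C + 1) * (t + h - a) = (C + 1) * (t - a) + (C + 1) * h by ring.
  rewrite /B e expRD ler_wpM2l ?expR_ge0 //.
  exact: expR_ge1Dx.
apply: (eq0_small B0) => e e0.
apply: (time_scale_induction hT (P := fun t => `|w t| <= e * B t) Ta Tb ab).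
- by rewrite wa normr0 mulr_ge0 ?expR_ge0 // ltW.
- move=> t Tt at_ tb ts Pt; have Kt := Tkappa_lt Tt Tb tb.
  rewrite (delta_derive_jump Tt (dw _ Kt)).
  have -> : w t + v t * w t * mu T t = w t * (1 + v t * mu T t) by ring.
  rewrite normrM; have m0 := mu_ge0 Tt.
  apply: (@le_trans _ _ (e * B t * (1 + (C + 1) * mu T t))); last first.
    rewrite -mulrA ler_wpM2l ?(ltW e0) //; apply: le_trans (Bh _ _) _.
    by rewrite /mu addrC subrK.
  apply: ler_pM => //; apply: le_trans (ler_normD _ _) _.
  rewrite normr1 lerD2l normrM (ger0_norm m0) ler_wpM2r //.
  by apply: le_trans (vC _ Tt at_ tb) _; lra.
- move=> t Tt at_ tb rt Pt; have Kt := Tkappa_lt Tt Tb tb.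
  have [del del0 h] := delta_derive_right_dense rt (dw _ Kt) e0.
  exists del => // s Ts ts std sb; have h1 : t - del < s by lra.
  have := h s Ts h1 std; rewrite (@ger0_norm _ (s - t)); last lra.
  move=> hs; have hp : 0 <= s - t by lra.
  apply: (@le_trans _ _ (e * B t * (1 + (C + 1) * (s - t)))); last first.
    rewrite -mulrA ler_wpM2l ?(ltW e0) //; apply: le_trans (Bh _ _) _.
    by rewrite [t + _]addrC subrK.
  have -> : w s = (w s - w t - v t * w t * (s - t)) + w t + v t * w t * (s - t) by ring.
  apply: le_trans (ler_normD _ _) _; apply: le_trans (lerD (ler_normD _ _) (lexx _)) _.
  rewrite !normrM (ger0_norm hp).
  have B1 : 1 <= B t.
    by rewrite -[leLHS]expR0 ler_expR mulr_ge0 //; lra.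
  have eB : e <= e * B t by rewrite ler_peMr // ltW.
  have vw : `|v t| * `|w t| <= C * (e * B t).
    by apply: ler_pM => //; exact: vC.
  have vwh : `|v t| * `|w t| * (s - t) <= C * (e * B t) * (s - t) by rewrite ler_wpM2r.
  have eh : e * (s - t) <= e * B t * (s - t) by rewrite ler_wpM2r.
  have -> : e * B t * (1 + (C + 1) * (s - t)) =
    e * B t + C * (e * B t) * (s - t) + e * B t * (s - t) by ring.
  lra.
- move=> t Tt at_ tb lt Pt; have Kt := Tkappa_left_limit hT Tt lt.
  rewrite -[w t]subr0.
  apply: (left_limit_norm_le lt (delta_derive_continuous Tt (dw _ Kt)) at_).
  move=> s Ts as_ st; rewrite subr0; apply: le_trans (Pt s Ts as_ st) _.
  rewrite ler_wpM2l ?(ltW e0) // ler_expR ler_wpM2l //; lra.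
Qed.

(** With x = C h one has (1 - 2x)(1 + 4x) = 1 + 2x(1 - 4x) >= 1 exactly on the range 0 <= x <= 1/4,
    and exp(4x) >= 1 + 4x. *)
Lemma expRN_le (C h : R) : 0 < C -> 0 <= h -> C * h <= 4^-1 ->
  expR (- (4 * C * h)) <= 1 - 2 * (C * h).
Proof.
move=> C0 h0 Ch; have x0 : 0 <= C * h by rewrite mulr_ge0 //; lra.
rewrite -mulrA; move: x0 Ch; set x := C * h => x0 x1.
rewrite expRN -[_^-1]mul1r ler_pdivrMr ?expR_gt0 //.
apply: (@le_trans _ _ ((1 - 2 * x) * (1 + 4 * x))); first by nra.
by rewrite ler_wpM2l ?expR_ge1Dx //; lra.
Qed.

(* On an interval of length at most [1 / (4 C)] the solution loses at most the
   factor [exp (- 4 C h)], so it stays positive across left-dense points. *)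
Lemma linear_positive_short v w a b C s0 t : 0 < C ->
  (forall t, Tkappa T t -> real_delta_derive w t (v t * w t)) ->
  (forall t, T t -> a <= t -> t < b -> `|v t| <= C) ->
  T s0 -> T t -> a <= s0 -> s0 <= t -> t <= b ->
  C * (t - s0) <= 4^-1 -> 0 < w s0 -> 0 < w t.
Proof.
move=> C0 dw vC Ts0 Tt as0 s0t tb Ct ws0.
pose B s := w s0 * expR (- (4 * C * (s - s0))).
have B0 s : 0 < B s by rewrite mulr_gt0 ?expR_gt0.
have Bh s h : 0 <= h -> C * h <= 4^-1 -> B (s + h) <= B s * (1 - 2 * (C * h)).
  move=> h0 Ch.
  have e : - (4 * C * (s + h - s0)) = - (4 * C * (s - s0)) - 4 * C * h by ring.
  rewrite /B e expRD mulrA.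
  by rewrite ler_wpM2l ?expRN_le // ltW // B0.
suff : B t <= w t by exact: (lt_le_trans (B0 t)).
have Cle x y : s0 <= x -> y <= t -> C * (y - x) <= 4^-1.
  by move=> sx yt; apply: le_trans Ct; rewrite ler_wpM2l //; lra.
apply: (time_scale_induction hT (P := fun s => B s <= w s) Ts0 Tt s0t).
- by rewrite /B subrr mulr0 oppr0 expR0 mulr1.
- move=> s Ts s0s st ss Ps; have Ks := Tkappa_lt Ts Tt st.
  have [_ _ sst] := sigma_spec hT Tt st.
  have sb : s < b by exact: lt_le_trans st tb.
  have as_ : a <= s by exact: le_trans as0 s0s.
  rewrite (delta_derive_jump Ts (dw _ Ks)); have m0 := mu_ge0 Ts.
  have Cm : C * mu T s <= 4^-1 by exact: Cle.
  have -> : sigma T s = s + mu T s by rewrite /mu addrC subrK.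
  apply: le_trans (Bh _ _ m0 Cm) _.
  have -> : w s + v s * w s * mu T s = w s * (1 + v s * mu T s) by ring.
  have vm : - (C * mu T s) <= v s * mu T s.
    rewrite -mulNr ler_wpM2r //.
    by have := vC _ Ts as_ sb; rewrite ler_norml => /andP[].
  have Cm0 : 0 <= C * mu T s by rewrite mulr_ge0 //; lra.
  by apply: ler_pM => //; [exact: ltW | lra | lra].
- move=> s Ts s0s st rs Ps; have Ks := Tkappa_lt Ts Tt st.
  have sb : s < b by exact: lt_le_trans st tb.
  have as_ : a <= s by exact: le_trans as0 s0s.
  have ws : 0 < w s by exact: lt_le_trans (B0 s) Ps.
  (* The drift and this tolerance each cost at most C (w s) h over a step h, hence the factor 1 - 2
     C h. *)
  have e0 : 0 < C * w s by rewrite mulr_gt0 //; lra.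
  have [del del0 h] := delta_derive_right_dense rs (dw _ Ks) e0.
  exists del => // r Tr sr rd rt; have h1 : s - del < r by lra.
  have hp : 0 <= r - s by lra.
  have := h r Tr h1 rd; rewrite (ger0_norm hp) ler_norml => /andP[hr _].
  have -> : r = s + (r - s) by ring.
  apply: le_trans (Bh _ _ hp (Cle _ _ s0s rt)) _.
  rewrite [s + (r - s)]addrC subrK.
  have vm : - (C * (w s * (r - s))) <= v s * (w s * (r - s)).
    rewrite -mulNr ler_wpM2r //; first by rewrite mulr_ge0 // ltW.
    by have := vC _ Ts as_ sb; rewrite ler_norml => /andP[].
  have Ch0 : C * (r - s) <= 4^-1 by exact: Cle.
  have : B s * (1 - 2 * (C * (r - s))) <= w s * (1 - 2 * (C * (r - s))).
    by rewrite ler_wpM2r //; lra.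
  have -> : w s * (1 - 2 * (C * (r - s))) = w s - 2 * (C * (w s * (r - s))) by ring.
  by rewrite -!mulrA in hr; lra.
- move=> s Ts s0s st ls Ps; have Ks := Tkappa_left_limit hT Ts ls.
  apply: (left_limit_ge ls (delta_derive_continuous Ts (dw _ Ks)) s0s) => r Tr s0r rs.
  apply: le_trans (Ps r Tr s0r rs).
  rewrite ler_wpM2l ?(ltW ws0) // ler_expR lerN2 ler_wpM2l //; lra.
Qed.

(** Regressivity carries positivity across jumps and continuity carries it to the right of
    right-dense points. At a left limit continuity alone would only give w >= 0, so the estimate on
    short intervals is started from a point within 1/(4C). *)
Lemma linear_positive_forward v w a b C : T a -> T b -> a <= b -> 0 < C ->
  (forall t, Tkappa T t -> real_delta_derive w t (v t * w t)) ->
  (forall t, T t -> a <= t -> t < b -> `|v t| <= C) ->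
  (forall t, T t -> a <= t -> t < b -> 0 < 1 + mu T t * v t) ->
  0 < w a -> 0 < w b.
Proof.
move=> Ta Tb ab C0 dw vC reg wa.
apply: (time_scale_induction hT (P := fun t => 0 < w t) Ta Tb ab) => //.
- move=> t Tt at_ tb ts Pt; have Kt := Tkappa_lt Tt Tb tb.
  rewrite (delta_derive_jump Tt (dw _ Kt)).
  have -> : w t + v t * w t * mu T t = w t * (1 + mu T t * v t) by ring.
  by rewrite mulr_gt0 // reg.
- move=> t Tt at_ tb rt Pt; have Kt := Tkappa_lt Tt Tb tb.
  have [del del0 h] := delta_derive_continuous Tt (dw _ Kt) Pt.
  exists del => // s Ts ts sd sb; have h1 : t - del < s by lra.
  by have := h s Ts h1 sd; rewrite ltr_distl subrr => /andP[].
- move=> t Tt at_ tb lt Pt.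
  have d0 : 0 < Num.min (t - a) (4 * C)^-1.
    by rewrite lt_min subr_gt0 at_ invr_gt0 /=; lra.
  have [s [Ts ds st]] := lt _ d0.
  have m1 : Num.min (t - a) (4 * C)^-1 <= t - a by rewrite ge_min lexx.
  have m2 : Num.min (t - a) (4 * C)^-1 <= (4 * C)^-1 by rewrite ge_min lexx orbT.
  have as_ : a <= s by lra.
  apply: (linear_positive_short C0 dw vC Ts Tt as_ (ltW st) tb _ (Pt s Ts as_ st)).
  have -> : 4^-1 = C * (4 * C)^-1 by field; lra.
  by rewrite ler_wpM2l //; lra.
Qed.

End RealDeltaDerivative.

(** * Delta derivative of a logarithm *)

Section Logarithm.
Variables (R : realType) (T : set R) (hT : time_scale T).
Implicit Types (f g v w : R -> R) (t d : R).

(** Near t the distance |sigma(t) - s| stays above mu/2, so the allowed error is at least e mu/2: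
    half goes to f s - f t, half to d (s - t). *)
Lemma delta_derive_scattered f t : T t -> t < sigma T t -> ts_continuous_at T f t ->
  real_delta_derive T f t ((f (sigma T t) - f t) / mu T t).
Proof.
move=> Tt ts cf e e0; have m0 : 0 < mu T t by rewrite subr_gt0.
set d := _ / _; have nd := normr_ge0 d.
have hd : f (sigma T t) = f t + d * mu T t.
  by rewrite /d divfK ?gt_eqF // addrC subrK.
have em0 : 0 < e * mu T t / 4 by rewrite divr_gt0 ?mulr_gt0.
have [del del0 h] := cf _ em0.
pose r := e * mu T t / 4 / (`|d| + 1).
have r0 : 0 < r by rewrite divr_gt0 //; lra.
have rE : (`|d| + 1) * r = e * mu T t / 4 by rewrite mulrC divfK //; lra.
exists (Num.min del (Num.min (mu T t / 2) r)) => [|s Ts s1 s2].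
  by rewrite !lt_min del0 r0 divr_gt0.
have := near_lt s1 s2; rewrite !lt_min => /and3P[sd sm sr].
have hs : `|f s - f t| < e * mu T t / 4.
  by apply: h => //; move: sd; rewrite ltr_distl => /andP[]; lra.
rewrite hd; have -> : f t + d * mu T t - f s - d * (sigma T t - s) =
    - (f s - f t) + d * (s - t) by rewrite /mu; ring.
apply: le_trans (ler_normD _ _) _; rewrite normrN normrM.
have b2 : `|d| * `|s - t| <= `|d| * r by rewrite ler_wpM2l // ltW.
have b3 : mu T t / 2 <= `|sigma T t - s|.
  have -> : sigma T t - s = mu T t - (s - t) by rewrite /mu; ring.
  apply: le_trans (lerB_dist _ _); rewrite (gtr0_norm m0); lra.
have b4 : e * (mu T t / 2) <= e * `|sigma T t - s| by rewrite ler_wpM2l // ltW.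
rewrite mulrDl mul1r in rE; lra.
Qed.

Lemma ts_continuous_ln w t : 0 < w t -> ts_continuous_at T w t ->
  ts_continuous_at T (fun s => ln (w s)) t.
Proof.
move=> w0 cw e e0.
have /cvgrPdist_lt /(_ e e0) /nbhs_ballP [r /= r0 hr] := continuous_ln w0.
have [del del0 h] := cw r r0; exists del => // s Ts s1 s2.
by rewrite distrC; apply: hr; rewrite /ball /= distrC; exact: h.
Qed.

(** The lower bound on ln(1 + x) is the upper bound ln(1 + y) <= y applied to 1/(1 + x) = 1 - x/(1 +
    x); the gap is x^2/(1 + x), with 1 + x >= 1/2. *)
Lemma ln1D_sub_le (x : R) : `|x| <= 2^-1 -> `|ln (1 + x) - x| <= 2 * x ^+ 2.
Proof.
rewrite ler_norml => /andP[x1 x2].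
have u1 : ln (1 + x) <= x by apply: le_ln1Dx; lra.
have p : 0 < 1 + x by lra.
have u2 : - ln (1 + x) <= - (x / (1 + x)).
  rewrite -lnV ?posrE // [X in ln X](_ : _ = 1 - x / (1 + x)); last by field; lra.
  by apply: le_ln1Dx; rewrite ltrN2 ltr_pdivrMr //; lra.
have u3 : x - x / (1 + x) <= 2 * x ^+ 2.
  have -> : x - x / (1 + x) = x ^+ 2 / (1 + x) by field; lra.
  rewrite ler_pdivrMr //; have := sqr_ge0 x; nra.
have := sqr_ge0 x; rewrite ler_norml => ?; apply/andP; split; lra.
Qed.

(** The value is the real form of xi_mu(d). At a right-scattered point 1 + mu d = w(sigma(t))/w(t),
    and the difference quotient of ln w results; at a right-dense one ln is linearised in the
    relative increment y of w. *)
Lemma delta_derive_ln w t d : T t -> 0 < w t -> 0 < w (sigma T t) ->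
  real_delta_derive T w t (d * w t) ->
  real_delta_derive T (fun s => ln (w s)) t
    (if mu T t == 0 then d else ln (1 + mu T t * d) / mu T t).
Proof.
move=> Tt w0 ws dw; have := sigma_ge hT Tt; rewrite le_eqVlt => /orP[/eqP e|lts].
  rewrite /mu -e subrr eqxx; have nd := normr_ge0 d.
  move=> eps e0; pose K := `|d| + 1; have K0 : 0 < K by rewrite /K; lra.
  pose e1 := Num.min (eps / 2) 1.
  have e10 : 0 < e1 by rewrite lt_min ltr01 divr_gt0.
  have e11 : e1 <= 1 by rewrite ge_min lexx orbT.
  have e1e : e1 <= eps / 2 by rewrite ge_min lexx.
  have [del del0 h] := delta_derive_right_dense (esym e) dw (mulr_gt0 w0 e10).
  (* As |y| <= K |s - t|, the radius [r1] gives |y| <= 1/2, and [r2] makes the quadratic error 2 y^2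
     at most half of the tolerance. *)
  pose r1 := (2 * K)^-1; pose r2 := eps / (4 * K ^+ 2).
  have r10 : 0 < r1 by rewrite invr_gt0 mulr_gt0.
  have r20 : 0 < r2 by rewrite divr_gt0 // mulr_gt0 // exprn_gt0.
  have r1E : K * r1 = 2^-1 by rewrite /r1; field; lra.
  have r2E : 2 * K ^+ 2 * r2 = eps / 2 by rewrite /r2; field; lra.
  exists (Num.min del (Num.min r1 r2)) => [|s Ts s1 s2].
    by rewrite !lt_min del0 r10 r20.
  have := near_lt s1 s2; rewrite !lt_min => /and3P[sd sr1 sr2].
  have hs : `|w s - w t - d * w t * (s - t)| <= w t * e1 * `|s - t|.
    by apply: h => //; move: sd; rewrite ltr_distl => /andP[]; lra.
  pose y := (w s - w t) / w t.
  have yE : w s - w t = y * w t by rewrite /y divfK // gt_eqF.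
  have hy : `|y - d * (s - t)| <= e1 * `|s - t|.
    rewrite -(ler_pM2l w0) mulrA; apply: le_trans hs.
    have -> : w s - w t - d * w t * (s - t) = w t * (y - d * (s - t)).
      by rewrite yE; ring.
    by rewrite normrM (gtr0_norm w0).
  have yK : `|y| <= K * `|s - t|.
    have -> : y = (y - d * (s - t)) + d * (s - t) by ring.
    apply: le_trans (ler_normD _ _) _; rewrite normrM /K mulrDl mul1r addrC.
    rewrite lerD2l; apply: le_trans hy _; rewrite ler_piMl //.
  have y2 : `|y| <= 2^-1.
    by apply: le_trans yK _; rewrite -r1E ler_wpM2l // ltW.
  have wsE : w s = w t * (1 + y) by rewrite mulrDr mulr1 [w t * y]mulrC -yE; ring.
  have y1 : 0 < 1 + y by move: y2; rewrite ler_norml => /andP[]; lra.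
  rewrite -e wsE lnM ?posrE //.
  have -> : ln (w t) - (ln (w t) + ln (1 + y)) - d * (t - s) =
    - ((ln (1 + y) - y) + (y - d * (s - t))) by ring.
  rewrite normrN; apply: le_trans (ler_normD _ _) _.
  have b1 := ln1D_sub_le y2.
  have b2 : y ^+ 2 <= K ^+ 2 * `|s - t| * `|s - t|.
    rewrite -real_normK ?num_real // -mulrA -expr2 -exprMn.
    by rewrite ler_sqr ?nnegrE // mulr_ge0 // ltW.
  have b3 : 2 * (K ^+ 2 * `|s - t| * `|s - t|) <= eps / 2 * `|s - t|.
    rewrite mulrA [2 * (_ * `|_|)]mulrA; apply: ler_wpM2r => //; rewrite -r2E.
    by apply: ler_wpM2l; [rewrite mulr_ge0 // sqr_ge0 | exact: ltW].
  have b4 : e1 * `|s - t| <= eps / 2 * `|s - t| by rewrite ler_wpM2r.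
  rewrite [`|t - s|]distrC; lra.
have m0 : 0 < mu T t by rewrite subr_gt0.
rewrite gt_eqF //.
have -> : ln (1 + mu T t * d) = ln (w (sigma T t)) - ln (w t).
  rewrite -ln_div ?posrE //; congr ln; rewrite (delta_derive_jump hT Tt dw).
  by field; rewrite gt_eqF.
apply: (delta_derive_scattered (f := fun s => ln (w s)) Tt lts).
exact: ts_continuous_ln w0 (delta_derive_continuous hT Tt dw).
Qed.

End Logarithm.

(** * The delta integral and the exponential *)

Section QuaternionExponential.
Variables (R : realType) (T : set R) (hT : time_scale T).
Local Notation H := (quat R).
Implicit Types (F G : R -> H) (f g : R -> R) (t d : R).

Lemma quat_component_le (q : H) (e : R) : quat_norm q <= e ->
  [/\ `|qre q| <= e, `|qi q| <= e, `|qj q| <= e & `|qk q| <= e].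
Proof.
move=> qe; have := sqr_ge0 (qre q); have := sqr_ge0 (qi q).
have := sqr_ge0 (qj q); have := sqr_ge0 (qk q) => d2 c2 b2 a2.
have h (x : R) : x ^+ 2 <= qre q ^+ 2 + qi q ^+ 2 + qj q ^+ 2 + qk q ^+ 2 ->
  `|x| <= e.
  by move=> hx; apply: le_trans qe; rewrite -sqrtr_sqr ler_wsqrtr.
by split; apply: h; lra.
Qed.

Lemma quat_norm_real (x : R) : quat_norm (quat_of_real x) = `|x|.
Proof. by rewrite /quat_norm /= expr0n /= !addr0 sqrtr_sqr. Qed.

Lemma quat_of_realB (x y : R) : quat_of_real (x - y) = quat_of_real x - quat_of_real y.
Proof. by apply: quatP => /=; ring. Qed.
Lemma quat_of_realM (x y : R) : quat_of_real (x * y) = quat_of_real x * quat_of_real y.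
Proof. by apply: quatP => /=; ring. Qed.
Lemma quat_of_realX (x : R) n : quat_of_real (x ^+ n) = quat_of_real x ^+ n.
Proof. by elim: n => [//|n IH]; rewrite !exprS quat_of_realM IH. Qed.

Lemma is_delta_derive_components F t (d : H) : is_delta_derive T F t d ->
  [/\ real_delta_derive T (fun s => qre (F s)) t (qre d),
      real_delta_derive T (fun s => qi (F s)) t (qi d),
      real_delta_derive T (fun s => qj (F s)) t (qj d) &
      real_delta_derive T (fun s => qk (F s)) t (qk d)].
Proof.
move=> dF; split=> e e0; have [del del0 h] := dF e e0; exists del => // s Ts s1 s2;
  have /= := quat_component_le (h s Ts s1 s2); rewrite !mulr0 !(subr0, addr0, add0r).
- by case.
- by case.
- by case.
- by case.
Qed.

Lemma is_delta_derive_real f t d : real_delta_derive T f t d ->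
  is_delta_derive T (fun s => quat_of_real (f s)) t (quat_of_real d).
Proof.
move=> df e e0; have [del del0 h] := df e e0; exists del => // s Ts s1 s2.
by rewrite -!quat_of_realB -quat_of_realM -quat_of_realB quat_norm_real; exact: h.
Qed.

Lemma real_delta_deriveB f g t d d' : real_delta_derive T f t d ->
  real_delta_derive T g t d' -> real_delta_derive T (fun s => f s - g s) t (d - d').
Proof.
move=> df dg e e0; have e20 : 0 < e / 2 by rewrite divr_gt0.
have [r1 r10 h1] := df _ e20; have [r2 r20 h2] := dg _ e20.
exists (Num.min r1 r2) => [|s Ts s1 s2]; first by rewrite lt_min r10.
have m1 : Num.min r1 r2 <= r1 by rewrite ge_min lexx.
have m2 : Num.min r1 r2 <= r2 by rewrite ge_min lexx orbT.
set x := sigma T t - s.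
have -> : f (sigma T t) - g (sigma T t) - (f s - g s) - (d - d') * x =
  (f (sigma T t) - f s - d * x) - (g (sigma T t) - g s - d' * x) by ring.
apply: le_trans (ler_normB _ _) _.
have {}h1 : `|f (sigma T t) - f s - d * x| <= e / 2 * `|x| by apply: h1 => //; lra.
have {}h2 : `|g (sigma T t) - g s - d' * x| <= e / 2 * `|x| by apply: h2 => //; lra.
lra.
Qed.

Lemma eq_real_delta_derive f g a b : T a -> T b ->
  (forall t, Tkappa T t -> exists d,
     real_delta_derive T f t d /\ real_delta_derive T g t d) ->
  f b - f a = g b - g a.
Proof.
move=> Ta Tb h.
have e : f b - g b = f a - g a.
  apply: (delta_derive0_constant (f := fun s => f s - g s) hT Ta Tb) => s Ks.
  have [d' [df dg]] := h s Ks.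
  by rewrite -(subrr d'); exact: real_delta_deriveB.
by rewrite -[f b](subrK (g b)) e; ring.
Qed.

Lemma antiderivative_unique (p : R -> H) F G a b : T a -> T b ->
  antiderivative T p F -> antiderivative T p G -> F b - F a = G b - G a.
Proof.
move=> Ta Tb dF dG.
have h t (Kt : Tkappa T t) := (is_delta_derive_components (dF t Kt),
                               is_delta_derive_components (dG t Kt)).
have key c : (forall t, Tkappa T t -> exists d,
      real_delta_derive T (fun s => c (F s)) t d /\
      real_delta_derive T (fun s => c (G s)) t d) ->
    c (F b) - c (F a) = c (G b) - c (G a).
  exact: (eq_real_delta_derive (f := fun s => c (F s)) (g := fun s => c (G s)) Ta Tb).
by apply: quatP; apply: key => t /h [[? ? ? ?] [? ? ? ?]]; eexists; split; eassumption.
Qed.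

Lemma delta_intE (p : R -> H) F a b : T a -> T b ->
  antiderivative T p F -> delta_int T p a b = F b - F a.
Proof.
move=> Ta Tb dF; rewrite /delta_int.
set S := [set q | _]; have Sx : S (F b - F a) by exists F.
have [G [dG ->]] : S (xget 0 S) by apply: xgetPex; exists (F b - F a).
exact: antiderivative_unique dG dF.
Qed.

(** Every term of the series is real: the real component is by definition the series of [expR], and
    the other three sum zeros. *)
Lemma expq_real (x : R) : expq (quat_of_real x) = quat_of_real (expR x).
Proof.
have z (h : nat -> R) : (forall n, h n = 0) -> limn (series h) = 0.
  move=> h0; have -> : series h = fun=> 0.
    by apply/funext => n; rewrite /series /= big1 // => i _; rewrite h0.
  exact: lim_cst.
have c n : expq_coeff (quat_of_real x) n = quat_of_real (exp_coeff x n).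
  by rewrite /expq_coeff -quat_of_realX -quat_of_realM mulrC.
have E (f : H -> R) : series (fun n => f (expq_coeff (quat_of_real x) n)) =
    series (fun n => f (quat_of_real (exp_coeff x n))).
  by congr series; apply/funext => n; rewrite c.
by rewrite /expq !E; apply: quatP => //; exact: z.
Qed.

Lemma vecq_real (x : R) : vecq (quat_of_real x) = 0.
Proof. by []. Qed.

(** Positivity makes the sign term vanish; a negative real would contribute i pi. *)
Lemma Lnq_pos (x : R) : 0 < x -> Lnq (quat_of_real x) = quat_of_real (ln x).
Proof.
move=> x0; rewrite /Lnq vecq_real eqxx /= quat_norm_real gtr0_norm //.
by rewrite gtr0_sg // subrr mul0r mulr0 /quat_i; apply: quatP => /=; ring.
Qed.

Lemma xi_real (h x : R) : 0 < 1 + h * x ->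
  xi h (quat_of_real x) = quat_of_real (if h == 0 then x else ln (1 + h * x) / h).
Proof.
move=> hx; rewrite /xi; case: ifP => // _.
have -> : 1 + quat_of_real x * quat_of_real h = quat_of_real (1 + h * x).
  by apply: quatP => /=; ring.
by rewrite Lnq_pos // -quat_of_realM mulrC.
Qed.

Lemma Eexp_real (p : R -> H) (u F : R -> R) a b : T a -> T b ->
  (forall t, Tkappa T t -> p t = quat_of_real (u t)) ->
  (forall t, Tkappa T t -> 0 < 1 + mu T t * u t) ->
  (forall t, Tkappa T t -> real_delta_derive T F t
     (if mu T t == 0 then u t else ln (1 + mu T t * u t) / mu T t)) ->
  Eexp T p b a = quat_of_real (expR (F b - F a)).
Proof.
move=> Ta Tb pu reg dF; rewrite /Eexp -expq_real quat_of_realB; congr expq.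
apply: (delta_intE (F := fun s => quat_of_real (F s)) Ta Tb) => t Kt.
by rewrite pu // xi_real ?reg //; exact: is_delta_derive_real (dF t Kt).
Qed.

End QuaternionExponential.

(** * Growth and Lipschitz bounds for determinants *)

Section ComplexBounds.
Variable R : realType.
Local Notation C := R[i].
Local Notation normc := ComplexField.Normc.normc.

(** The norm of [R[i]] takes values in [R[i]]; the real-valued [normc] allows comparison with real
    bounds. *)
Lemma normcD (x y : C) : normc (x + y) <= normc x + normc y.
Proof.
have : `|x + y| <= `|x| + `|y| := ler_normD x y.
by rewrite -lecR rmorphD.
Qed.

Lemma normcN (x : C) : normc (- x) = normc x.
Proof. by case: x => a b /=; rewrite !sqrrN. Qed.

Lemma normcB (x y : C) : normc (x - y) <= normc x + normc y.
Proof. by rewrite -(normcN y) normcD. Qed.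

Lemma normc_ge0 (x : C) : 0 <= normc x.
Proof. by case: x => a b /=; exact: sqrtr_ge0. Qed.

Lemma normc_real (x : R) : normc x%:C%C = `|x|.
Proof. by rewrite /= expr0n /= addr0 sqrtr_sqr. Qed.

Lemma normcX (x : C) n : normc (x ^+ n) = normc x ^+ n.
Proof.
elim: n => [|n IH]; first by rewrite !expr0 ComplexField.Normc.normc1.
by rewrite !exprS ComplexField.Normc.normcM IH.
Qed.

Lemma Re_le_normc (x : C) : `|complex.Re x| <= normc x.
Proof.
by case: x => a b /=; rewrite -sqrtr_sqr ler_wsqrtr // lerDl sqr_ge0.
Qed.

Lemma Im_le_normc (x : C) : `|complex.Im x| <= normc x.
Proof.
by case: x => a b /=; rewrite -sqrtr_sqr ler_wsqrtr // lerDr sqr_ge0.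
Qed.

(** Used with g = 1 for boundedness on S, and with g = |h| for terms of first order in h. *)
Definition dominated (D : Type) (S : set D) (g : D -> R) (F : D -> C) :=
  exists B, forall x, S x -> normc (F x) <= B * g x.

Lemma dominated_sum (D I : Type) (S : set D) (g : D -> R) (r : seq I) (P : pred I)
    (F : I -> D -> C) : (forall i, P i -> dominated S g (F i)) ->
  dominated S g (fun x => \sum_(i <- r | P i) F i x).
Proof.
move=> hF; elim: r => [|i r [B hB]].
  by exists 0 => x _; rewrite big_nil mul0r ComplexField.Normc.normc0.
have [Pi|nPi] := boolP (P i); last first.
  by exists B => x Sx; rewrite big_cons (negbTE nPi); exact: hB.
have [B' hB'] := hF i Pi; exists (B' + B) => x Sx; rewrite big_cons Pi mulrDl.
by apply: le_trans (normcD _ _) _; apply: lerD; [exact: hB' | exact: hB].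
Qed.

Lemma dominatedM (D : Type) (S : set D) (F G : D -> C) :
  dominated S (fun=> 1) F -> dominated S (fun=> 1) G ->
  dominated S (fun=> 1) (fun x => F x * G x).
Proof.
move=> [B hB] [B' hB']; exists (B * B') => x Sx.
rewrite ComplexField.Normc.normcM mulr1.
have := hB x Sx; have := hB' x Sx; rewrite !mulr1 => h h'.
by apply: ler_pM => //; exact: normc_ge0.
Qed.

Lemma dominated_cst (D : Type) (S : set D) (c : C) :
  dominated S (fun=> 1) (fun=> c).
Proof. by exists (normc c) => x _; rewrite mulr1. Qed.

Lemma dominated_prod (D I : Type) (S : set D) (r : seq I) (F : I -> D -> C) :
  (forall i, dominated S (fun=> 1) (F i)) ->
  dominated S (fun=> 1) (fun x => \prod_(i <- r) F i x).
Proof.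
move=> hF; elim: r => [|i r IH].
  by exists (normc 1) => x _; rewrite big_nil mulr1.
have [B hB] := dominatedM (hF i) IH.
by exists B => x Sx; rewrite big_cons; exact: hB.
Qed.

Lemma dominated_exp (D : Type) (S : set D) (F : D -> C) n :
  dominated S (fun=> 1) F -> dominated S (fun=> 1) (fun x => F x ^+ n).
Proof.
move=> hF; elim: n => [|n IH]; first exact: dominated_cst.
have [B hB] := dominatedM hF IH.
by exists B => x Sx; rewrite exprS; exact: hB.
Qed.

Lemma dominated_det (D : Type) (S : set D) m (X : D -> 'M[C]_m) :
  (forall i j, dominated S (fun=> 1) (fun x => X x i j)) ->
  dominated S (fun=> 1) (fun x => \det (X x)).
Proof.
move=> hX; apply: dominated_sum => s _; apply: dominatedM.
  exact: dominated_cst.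
by apply: dominated_prod.
Qed.

(** The sum u with mu freed into a variable h: differentiating W requires its values at s - t as
    well as at mu(t). *)
Definition minor_poly m (X : 'M[C]_m) (h : R) : C :=
  \sum_(1 <= k < m.+1) h%:C%C ^+ k.-1 * sum_principal_minors k X.

Lemma dominated_minor_poly (D : Type) (S : set D) m (X : D -> 'M[C]_m) (h : D -> R) :
  (forall i j, dominated S (fun=> 1) (fun x => X x i j)) ->
  dominated S (fun=> 1) (fun x => (h x)%:C%C) ->
  dominated S (fun=> 1) (fun x => minor_poly (X x) (h x)).
Proof.
move=> hX hh; apply: dominated_sum => k _; apply: dominatedM.
  exact: dominated_exp.
apply: dominated_sum => L _; apply: dominated_det => i j.
have [B hB] := hX (enum_val i) (enum_val j).
by exists B => x Sx; rewrite mxE; exact: hB.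
Qed.

(** The constant terms cancel, and for |h| <= 1 each higher power is at most |h|. *)
Lemma minor_poly_sub0_le m (X : 'M[C]_m) :
  exists2 B, 0 <= B & forall h, `|h| <= 1 ->
    normc (minor_poly X h - minor_poly X 0) <= B * `|h|.
Proof.
have [B hB] : dominated [set h : R | `|h| <= 1] (fun h => `|h|)
    (fun h => \sum_(1 <= k < m.+1)
       (h%:C%C ^+ k.-1 - 0%:C%C ^+ k.-1) * sum_principal_minors k X).
  apply: dominated_sum => k _; exists (normc (sum_principal_minors k X)) => h /= h1.
  rewrite ComplexField.Normc.normcM mulrC ler_wpM2l ?normc_ge0 //.
  case: k.-1 => [|n]; first by rewrite !expr0 subrr ComplexField.Normc.normc0.
  rewrite [0%:C%C ^+ _]exprS mul0r subr0 normcX normc_real exprS.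
  by rewrite ler_piMr // exprn_ile1.
exists `|B| => // h h1; rewrite /minor_poly -sumrB.
under eq_bigr do rewrite -mulrBl.
by apply: le_trans (hB h h1) _; rewrite ler_wpM2r // ler_norm.
Qed.

(** One L serves both as Lipschitz constant and as bound on the product, which closes the induction
    through x X - y Y = x (X - Y) + (x - y) Y. *)
Lemma prod_lipschitz (I : Type) (r : seq I) (K : R) : 0 <= K ->
  exists2 L, 0 <= L & forall (x y : I -> C) d, 0 <= d ->
    (forall i, normc (x i) <= K) -> (forall i, normc (y i) <= K) ->
    (forall i, normc (x i - y i) <= d) ->
    normc (\prod_(i <- r) x i - \prod_(i <- r) y i) <= L * d /\
    normc (\prod_(i <- r) y i) <= L.
Proof.
move=> K0; elim: r => [|i r [L L0 IH]].
  exists 1 => // x y d d0 _ _ _; rewrite !big_nil subrr.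
  by rewrite ComplexField.Normc.normc0 ComplexField.Normc.normc1 mul1r.
exists (K * L + L) => [|x y d d0 xK yK xy]; first by rewrite addr_ge0 ?mulr_ge0.
have [h1 h2] := IH x y d d0 xK yK xy; rewrite !big_cons.
set X := \prod_(_ <- _) x _ in h1 *; set Y := \prod_(_ <- _) y _ in h1 h2 *.
split; last first.
  rewrite ComplexField.Normc.normcM; apply: (@le_trans _ _ (K * L)).
    by apply: ler_pM => //; exact: normc_ge0.
  by rewrite lerDl.
have -> : x i * X - y i * Y = x i * (X - Y) + (x i - y i) * Y by ring.
apply: le_trans (normcD _ _) _; rewrite !ComplexField.Normc.normcM mulrDl.
rewrite -mulrA [L * d]mulrC; apply: lerD; last first.
  by apply: ler_pM => //; exact: normc_ge0.
by apply: ler_pM; rewrite ?normc_ge0 // mulrC.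
Qed.

Lemma det_lipschitz m (K : R) : 0 <= K ->
  exists2 L, 0 <= L & forall (X Y : 'M[C]_m) d, 0 <= d ->
    (forall i j, normc (X i j) <= K) -> (forall i j, normc (Y i j) <= K) ->
    (forall i j, normc (X i j - Y i j) <= d) ->
    normc (\det X - \det Y) <= L * d.
Proof.
move=> K0; have [L L0 hL] := prod_lipschitz (index_enum 'I_m) K0.
exists (\sum_(s : 'S_m) L) => [|X Y d d0 XK YK XY]; first by rewrite sumr_ge0.
rewrite /determinant -sumrB mulr_suml.
elim/big_rec2: _ => [|s z u _ hz]; first by rewrite ComplexField.Normc.normc0.
apply: le_trans (normcD _ _) _; apply: lerD => //.
rewrite -mulrBr ComplexField.Normc.normcM normcX normcN ComplexField.Normc.normc1.
rewrite expr1n mul1r.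
by have [] := hL (fun i => X i (s i)) (fun i => Y i (s i)) d d0; [..|move=> ? _].
Qed.

End ComplexBounds.

(** * The delta derivative of the Wronskian *)

Section Wronskian.
Variables (R : realType) (T : set R) (hT : time_scale T).
Local Notation H := (quat R).
Local Notation C := R[i].
Local Notation normc := ComplexField.Normc.normc.

Lemma normc_chi_le n (Q : 'M[H]_n) (r : R) :
  (forall i j, quat_norm (Q i j) <= r) -> forall i j, normc (chi Q i j) <= r.
Proof.
move=> hQ.
have h1 i j : normc (cpart1 (Q i j)) <= r.
  apply: le_trans (hQ i j); rewrite /quat_norm /= ler_wsqrtr //.
  have := sqr_ge0 (qj (Q i j)); have := sqr_ge0 (qk (Q i j)); lra.
have h2 i j : normc (cpart2 (Q i j)) <= r.
  apply: le_trans (hQ i j); rewrite /quat_norm /= ler_wsqrtr //.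
  have := sqr_ge0 (qre (Q i j)); have := sqr_ge0 (qi (Q i j)); lra.
have nconj (z : C) : normc (z^*)%C = normc z by case: z => a b /=; rewrite sqrrN.
by move=> i j; rewrite !mxE; case: (fintype.split i) => i';
  rewrite !mxE; case: (fintype.split j) => j'; rewrite !mxE ?normcN ?nconj.
Qed.

Lemma entries_bounded m p (X : 'M[C]_(m, p)) :
  exists2 K, 0 <= K & forall i j, normc (X i j) <= K.
Proof.
exists (\sum_i \sum_j normc (X i j)).
  by apply: sumr_ge0 => i _; apply: sumr_ge0 => j _; exact: normc_ge0.
move=> i j; rewrite (bigD1 i) //= (bigD1 j) //= -addrA lerDl addr_ge0 //.
  by apply: sumr_ge0 => k _; exact: normc_ge0.
by apply: sumr_ge0 => k _; apply: sumr_ge0 => l _; exact: normc_ge0.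
Qed.

Lemma det_chi_1addZ n (A : 'M[H]_n) (h : R) :
  \det (chi (1%:M + quat_of_real h *: A)) = 1 + h%:C%C * minor_poly (chi A) h.
Proof. by rewrite chiD chi1 chiZ det_1addZ. Qed.

Lemma liouville_coeffE n (A : R -> 'M[H]_n) t :
  liouville_coeff T A t = minor_poly (chi (A t)) (mu T t).
Proof.
rewrite /liouville_coeff /minor_poly.
by have -> : (2 * n = n + n)%N by rewrite mul2n addnn.
Qed.

(** For h != 0 the determinant of chi(I + h A), which is 1 + h p(h), is real, and h can be divided
    out. The value at h = 0, needed at right-dense points, follows by letting h tend to 0. *)
Lemma Im_minor_poly_chi n (A : 'M[H]_n) (h : R) :
  complex.Im (minor_poly (chi A) h) = 0.
Proof.
have nz (x : R) : x != 0 -> complex.Im (minor_poly (chi A) x) = 0.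
  move=> x0; have := congr1 (@complex.Im R) (det_chi_real (1%:M + quat_of_real x *: A)).
  rewrite det_chi_1addZ; case: (minor_poly _ _) => p q /= E.
  have /eqP : x * q = 0 by lra.
  by rewrite mulf_eq0 (negbTE x0) => /eqP.
have [->|] := eqVneq h 0; last exact: nz.
have ImB (y z : C) : complex.Im (y - z) = complex.Im y - complex.Im z.
  by case: y => ? ?; case: z.
have [B B0 hB] := minor_poly_sub0_le (chi A).
apply: (eq0_small B0) => e e0; pose x := Num.min 1 e.
have x0 : 0 < x by rewrite lt_min ltr01.
have x1 : `|x| <= 1 by rewrite gtr0_norm // ge_min lexx.
have := le_trans (Im_le_normc _) (hB x x1).
rewrite (ImB (minor_poly (chi A) x)) (nz x (lt0r_neq0 x0)) [0 - _]sub0r normrN.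
move=> /le_trans; apply.
by rewrite gtr0_norm // mulrC ler_wpM2r // ge_min lexx orbT.
Qed.

Definition ts_near (t : R) (P : R -> Prop) := exists2 del, 0 < del &
  forall s, T s -> t - del < s -> s < t + del -> P s.

Lemma ts_near_and t P Q : ts_near t P -> ts_near t Q -> ts_near t (fun s => P s /\ Q s).
Proof.
move=> [d1 d10 h1] [d2 d20 h2]; exists (Num.min d1 d2) => [|s Ts s1 s2].
  by rewrite lt_min d10.
have m1 : Num.min d1 d2 <= d1 by rewrite ge_min lexx.
have m2 : Num.min d1 d2 <= d2 by rewrite ge_min lexx orbT.
by split; [apply: h1 => //; lra | apply: h2 => //; lra].
Qed.

Lemma ts_near_forall (I : finType) t (P : I -> R -> Prop) :
  (forall i, ts_near t (P i)) -> ts_near t (fun s => forall i, P i s).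
Proof.
move=> hP.
have [d d0 h] : ts_near t (fun s => forall i, i \in enum I -> P i s).
  elim: (enum I) => [|i r IH]; first by exists 1.
  have [d d0 h] := ts_near_and (hP i) IH; exists d => // s Ts s1 s2 k.
  by have [h1 h2] := h s Ts s1 s2; rewrite inE => /orP[/eqP->|]; [|exact: h2].
by exists d => // s Ts s1 s2 i; apply: h => //; rewrite mem_enum.
Qed.

Lemma solution_matrix_entry n (A M : R -> 'M[H]_n) t i j :
  solution_matrix T A M -> Tkappa T t ->
  is_delta_derive T (fun s => M s i j) t ((A t *m M t) i j).
Proof.
move=> hM Kt; have := hM j t Kt i 0.
have -> : (fun s => (col j (M s)) i 0) = (fun s => M s i j).
  by apply/funext => s; rewrite mxE.
have -> // : (A t *m col j (M t)) i 0 = (A t *m M t) i j.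
by rewrite !mxE; apply: eq_bigr => k _; rewrite mxE.
Qed.

Lemma solution_matrix_sigma n (A M : R -> 'M[H]_n) t :
  solution_matrix T A M -> Tkappa T t ->
  M (sigma T t) = (1%:M + quat_of_real (mu T t) *: A t) *m M t.
Proof.
move=> hM Kt; have Tt : T t by case: Kt.
apply/matrixP => i j; rewrite mulmxDl mul1mx -scalemxAl mxE [in RHS]mxE.
have [h1 h2 h3 h4] := is_delta_derive_components (solution_matrix_entry i j hM Kt).
set q := (A t *m M t) i j in h1 h2 h3 h4 *.
by apply: quatP; rewrite (delta_derive_jump hT Tt h1, delta_derive_jump hT Tt h2,
  delta_derive_jump hT Tt h3, delta_derive_jump hT Tt h4) /=; ring.
Qed.

(** At a right-dense point mu = 0 and the polynomial increment is O(|s - t|), so the product is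
    quadratic. At a right-scattered point the increment is merely bounded, but |s - t| is small
    against |sigma(t) - s| >= mu/2. *)
Lemma minor_poly_increment_near m (X : 'M[C]_m) (t W e : R) : T t -> 0 <= W -> 0 < e ->
  ts_near t (fun s =>
    `|s - t| * normc (minor_poly X (mu T t) - minor_poly X (s - t)) * W
      <= e * `|sigma T t - s|).
Proof.
move=> Tt W0 e0; have [B B0 hB] := minor_poly_sub0_le X.
have := sigma_ge hT Tt; rewrite le_eqVlt => /orP[/eqP et|lts].
  have BW : 0 <= B * W by rewrite mulr_ge0.
  pose r := e / (B * W + 1).
  have r0 : 0 < r by rewrite divr_gt0 //; lra.
  have rE : r * (B * W + 1) = e by rewrite divfK //; lra.
  exists (Num.min 1 r) => [|s Ts s1 s2]; first by rewrite lt_min ltr01.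
  have := near_lt s1 s2; rewrite lt_min => /andP[h1 hr].
  rewrite /mu -et [t - t]subrr -[normc _]normcN (opprB (minor_poly X 0)).
  rewrite [`|t - s|]distrC.
  have nh := normr_ge0 (s - t).
  have {}hB : normc (minor_poly X (s - t) - minor_poly X 0) * W <= B * `|s - t| * W.
    by rewrite ler_wpM2r // hB // ltW.
  rewrite -mulrA mulrC ler_wpM2r //; apply: le_trans hB _.
  rewrite mulrAC; have : B * W * `|s - t| <= B * W * r by rewrite ler_wpM2l // ltW.
  by rewrite mulrDr mulr1 in rE; lra.
have m0 : 0 < mu T t by rewrite subr_gt0.
pose K := (normc (minor_poly X (mu T t)) + (normc (minor_poly X 0) + B)) * W.
have K0 : 0 <= K by rewrite mulr_ge0 // !addr_ge0 // normc_ge0.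
have em : 0 < e * (mu T t / 2) by rewrite mulr_gt0 // divr_gt0.
pose r := e * (mu T t / 2) / (K + 1).
have r0 : 0 < r by rewrite divr_gt0 //; lra.
have rE : r * (K + 1) = e * (mu T t / 2) by rewrite divfK //; lra.
exists (Num.min 1 (Num.min (mu T t / 2) r)) => [|s Ts s1 s2].
  by rewrite !lt_min ltr01 divr_gt0.
have := near_lt s1 s2; rewrite !lt_min => /and3P[h1 hm hr].
have nh := normr_ge0 (s - t).
apply: (@le_trans _ _ (e * (mu T t / 2))); last first.
  rewrite ler_wpM2l ?(ltW e0) //.
  have -> : sigma T t - s = mu T t - (s - t) by rewrite /mu; ring.
  by apply: le_trans (lerB_dist _ _); rewrite (gtr0_norm m0); lra.
rewrite -mulrA; apply: (@le_trans _ _ (r * (K + 1))); last by rewrite rE.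
apply: ler_pM => //; [by rewrite mulr_ge0 ?normc_ge0 | exact: ltW |].
apply: (@le_trans _ _ K); last by rewrite lerDl.
rewrite ler_wpM2r //; apply: le_trans (normcB _ _) _; rewrite lerD2l.
have -> : minor_poly X (s - t) =
  minor_poly X 0 + (minor_poly X (s - t) - minor_poly X 0) by rewrite [RHS]addrC subrK.
apply: le_trans (normcD _ _) _; rewrite lerD2l.
apply: le_trans (hB _ (ltW h1)) _; rewrite ler_piMr // ltW //.
Qed.

Lemma Re_increment (p q m b : C) (x : R) : complex.Im m = 0 ->
  complex.Re (p - q - m * b * x%:C%C) =
  complex.Re p - complex.Re q - complex.Re m * complex.Re b * x.
Proof.
by case: p q m b => [p ?] [q ?] [m i] [b ?] /= ->; ring.
Qed.

(** With x = s - t, replacing M(s) by (I + x A(t)) M(t) costs a Lipschitz error in the determinant;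
    what then remains is x (p(mu) - p(x)) W(t), where p is the minor polynomial of chi_A(t). *)
Lemma wronskian_delta_derive n (A M : R -> 'M[H]_n) t :
  solution_matrix T A M -> Tkappa T t ->
  real_delta_derive T (fun s => complex.Re (wronskian M s)) t
    (complex.Re (liouville_coeff T A t) * complex.Re (wronskian M t)).
Proof.
move=> hM Kt e e0; have Tt : T t by case: Kt.
have m0 := mu_ge0 hT Tt.
rewrite liouville_coeffE; set X := chi (A t); set B := chi (M t).
have [K1 K10 hK1] := entries_bounded B.
have [K2 K20 hK2] := entries_bounded (X *m B).
have [L L0 hL] := det_lipschitz (n + n) (K := K1 + K2 + 1) ltac:(lra).
(* The first term makes the Lipschitz error at most half of the tolerance; the second makes the
   entrywise error at most 1, which is the 1 in the bound K1 + K2 + 1 behind [L]. *)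
pose e1 := Num.min (e / 2 / (L + 1)) (mu T t + 1)^-1.
have e10 : 0 < e1 by rewrite lt_min !divr_gt0 ?invr_gt0 //; lra.
have e1m : e1 * (mu T t + 1) <= 1.
  by rewrite -ler_pdivlMr ?div1r ?ge_min ?lexx ?orbT //; lra.
have e1L : L * e1 <= e / 2.
  apply: (@le_trans _ _ ((L + 1) * e1)); first by rewrite ler_wpM2r ?(ltW e10) //; lra.
  by rewrite mulrC -ler_pdivlMr ?ge_min ?lexx //; lra.
have near1 : ts_near t (fun s => forall ij : 'I_n * 'I_n,
    quat_norm (M (sigma T t) ij.1 ij.2 - M s ij.1 ij.2 -
      (A t *m M t) ij.1 ij.2 * quat_of_real (sigma T t - s))
    <= e1 * `|sigma T t - s|).
  by apply: ts_near_forall => -[i j]; exact: solution_matrix_entry hM Kt e1 e10.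
have e20 : 0 < e / 2 by rewrite divr_gt0.
have near2 := minor_poly_increment_near X Tt (normc_ge0 (\det B)) e20.
have near3 : ts_near t (fun s => `|s - t| < 1).
  by exists 1 => // s _; exact: near_lt.
have [del del0 h] := ts_near_and near1 (ts_near_and near2 near3).
exists del => // s Ts s1 s2; have [d1 [d2 d3]] := h s Ts s1 s2.
pose x := s - t; pose Y := chi ((1%:M + quat_of_real x *: A t) *m M t).
have dY : \det Y = (1 + x%:C%C * minor_poly X x) * \det B.
  by rewrite /Y chiM det_mulmx det_chi_1addZ.
have dS : \det (chi (M (sigma T t))) =
    (1 + (mu T t)%:C%C * minor_poly X (mu T t)) * \det B.
  rewrite [M (sigma T t)](solution_matrix_sigma hM Kt) chiM det_mulmx.
  by rewrite det_chi_1addZ -/X -/B.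
have sx : sigma T t - s = mu T t - x by rewrite /x /mu; ring.
have YB : Y = B + x%:C%C *: (X *m B).
  by rewrite /Y chiM chiD chi1 chiZ mulmxDl mul1mx scalemxAl.
have hY i j : normc (Y i j) <= K1 + K2.
  rewrite YB mxE [in X in _ + X]mxE; apply: le_trans (normcD _ _) _.
  apply: lerD => //; rewrite ComplexField.Normc.normcM normc_real.
  by apply: le_trans (hK2 i j); rewrite ler_piMl ?normc_ge0 // ltW.
pose d := e1 * `|sigma T t - s|.
have d0 : 0 <= d by rewrite mulr_ge0 // ltW.
have dle1 : d <= 1.
  apply: le_trans e1m; rewrite ler_wpM2l ?(ltW e10) // sx.
  by apply: le_trans (ler_normB _ _) _; rewrite ger0_norm // lerD2l ltW.
have hE i j : normc (Y i j - chi (M s) i j) <= d.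
  pose Q := M (sigma T t) - M s - quat_of_real (sigma T t - s) *: (A t *m M t).
  have -> : Y i j - chi (M s) i j = chi Q i j.
    have -> : Y = chi (M s) + chi Q; last by rewrite mxE addrAC subrr add0r.
    rewrite -chiD /Y; congr chi; rewrite /Q (solution_matrix_sigma hM Kt) sx.
    rewrite !mulmxDl !mul1mx -!scalemxAl quat_of_realB scalerBl.
    move: (quat_of_real x *: _) (quat_of_real (mu T t) *: _) => V U.
    by rewrite opprB [RHS]addrC [RHS]addrAC subrK [V - U]addrC addrA addrK.
  apply: normc_chi_le => k l; have := d1 (k, l); rewrite /Q !mxE /=.
  congr (quat_norm (_ - _) <= _).
  by apply: quatP => /=; ring.
have hMs i j : normc (chi (M s) i j) <= K1 + K2 + 1.
  have -> : chi (M s) i j = Y i j - (Y i j - chi (M s) i j) by ring.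
  apply: le_trans (normcB _ _) _; apply: lerD => //.
  exact: le_trans (hE i j) dle1.
have hY1 i j : normc (Y i j) <= K1 + K2 + 1 by have := hY i j; lra.
have D := hL Y (chi (M s)) d d0 hY1 hMs hE.
pose Z := \det (chi (M (sigma T t))) - \det (chi (M s)) -
  minor_poly X (mu T t) * \det B * (sigma T t - s)%:C%C.
have ImX := Im_minor_poly_chi (A t) (mu T t).
have -> : complex.Re (wronskian M (sigma T t)) - complex.Re (wronskian M s) -
    complex.Re (minor_poly X (mu T t)) * complex.Re (wronskian M t) * (sigma T t - s)
    = complex.Re Z.
  by rewrite /Z Re_increment.
apply: le_trans (Re_le_normc _) _.
(* The mu p(mu) terms cancel, leaving x p(mu) where the determinant of [Y] has x p(x). *)
have -> : Z = (\det Y - \det (chi (M s))) +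
    x%:C%C * (minor_poly X (mu T t) - minor_poly X x) * \det B.
  have hx : (sigma T t - s)%:C%C = (mu T t)%:C%C - x%:C%C :> C.
    by rewrite sx; exact: (rmorphB (real_complex R)).
  rewrite /Z dY dS hx.
  move: (\det B) (\det (chi (M s))) (minor_poly X (mu T t)) (minor_poly X x).
  by move: (real_complex R x) (real_complex R (mu T t)) => *; ring.
apply: le_trans (normcD _ _) _; rewrite !ComplexField.Normc.normcM normc_real.
have L1 : L * d <= e / 2 * `|sigma T t - s| by rewrite /d mulrA ler_wpM2r.
rewrite -/x in d2; lra.
Qed.

End Wronskian.

(** * Boundedness of u and the Liouville formula *)

Section Liouville.
Variables (R : realType) (T : set R) (hT : time_scale T).
Local Notation H := (quat R).
Local Notation normc := ComplexField.Normc.normc.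

(** Compactness is replaced by induction on boundedness over [a, t]. At a left limit the hypothesis
    is used at a single nearby r; the one-sided limit controls f between r and t, and f t is added
    separately since it may differ from that limit. *)
Lemma rd_continuous_bounded (f : R -> R) a b : rd_continuous_real T f ->
  T a -> T b -> a <= b ->
  exists K, forall s, T s -> a <= s -> s <= b -> `|f s| <= K.
Proof.
move=> [fr fl] Ta Tb ab.
have near_bound (S : set R) (t l : R) : f x @[x --> within S (nbhs t)] --> l ->
    exists2 d : R, 0 < d & forall s, S s -> `|s - t| < d -> `|f s| <= `|l| + 1.
  move=> /cvgrPdist_lt /(_ 1 ltr01); rewrite near_withinE => /nbhs_ballP[d /= d0 hd].
  exists d => // s Ss sd; have {}hd : `|l - f s| < 1.
    by apply: hd Ss; rewrite /ball /= distrC.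
  rewrite -(subrK l (f s)) addrC; apply: le_trans (ler_normD _ _) _.
  by rewrite lerD2l distrC ltW.
apply: (time_scale_induction hT (P := fun t =>
  exists K, forall s, T s -> a <= s -> s <= t -> `|f s| <= K) Ta Tb ab).
- exists `|f a| => s _ as_ sa; suff -> : s = a by [].
  by apply/eqP; rewrite eq_le sa as_.
- move=> t Tt at_ tb ts [K hK]; exists (Num.max K `|f (sigma T t)|) => s Ts as_ ss.
  rewrite le_max; have [st|st] := leP s t; first by rewrite hK.
  suff -> : s = sigma T t by rewrite lexx orbT.
  by apply/eqP; rewrite eq_le ss; have [_ _ ->] := sigma_spec hT Ts st.
- move=> t Tt at_ tb rt [K hK]; have [d d0 hd] := near_bound _ _ _ (fr t Tt rt).
  exists d => // s Ts ts sd sb; exists (Num.max K (`|f t| + 1)) => r Tr ar rs.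
  rewrite le_max; have [rt'|rt'] := leP r t; first by rewrite hK.
  rewrite (hd r Tr) ?orbT // gtr0_norm; lra.
- move=> t Tt at_ tb lt IH.
  have [l hl] := fl t Tt (left_limit_dense lt).
  have [d d0 hd] := near_bound _ _ _ hl.
  have d1 : 0 < Num.min d (t - a) by rewrite lt_min d0 subr_gt0.
  have [r [Tr dr rt]] := lt _ d1.
  have m1 : Num.min d (t - a) <= d by rewrite ge_min lexx.
  have m2 : Num.min d (t - a) <= t - a by rewrite ge_min lexx orbT.
  have ar : a <= r by lra.
  have [K hK] := IH r Tr ar rt.
  exists (Num.max K (Num.max (`|l| + 1) `|f t|)) => s Ts as_ st; rewrite !le_max.
  have [sr|sr] := leP s r; first by rewrite hK.
  move: st; rewrite le_eqVlt => /orP[/eqP->|st]; first by rewrite lexx !orbT.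
  have sd : `|s - t| < d by rewrite ltr0_norm; lra.
  by rewrite (hd s (conj Ts st) sd) orbT.
Qed.

(** u is a polynomial in mu and the entries of chi_A. The interval is half-open because s < b forces
    sigma(s) <= b, whence mu(s) <= b - a. *)
Lemma liouville_coeff_bounded n (A : R -> 'M[H]_n) a b : rd_continuous_mx T A ->
  T a -> T b -> a <= b ->
  exists2 K, 0 < K &
    forall s, T s -> a <= s -> s < b -> `|complex.Re (liouville_coeff T A s)| <= K.
Proof.
move=> rA Ta Tb ab; pose S := [set s | [/\ T s, a <= s & s < b]].
have dom (f g : R -> R) : rd_continuous_real T f -> rd_continuous_real T g ->
    dominated S (fun=> 1) (fun s => Complex (f s) (g s)).
  move=> /rd_continuous_bounded /(_ Ta Tb ab)[K hK].
  move=> /rd_continuous_bounded /(_ Ta Tb ab)[K' hK'].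
  exists (K + K') => s [Ts as_ sb]; rewrite mulr1.
  have -> : Complex (f s) (g s) = Complex (f s) 0 + Complex 0 (g s).
    by apply/eqP; rewrite eq_complex /= addr0 add0r !eqxx.
  apply: le_trans (normcD _ _) _; rewrite /= !expr0n /= addr0 add0r !sqrtr_sqr.
  by apply: lerD; [apply: hK | apply: hK'] => //; exact: ltW.
have domN (F : R -> R[i]) : dominated S (fun=> 1) F ->
    dominated S (fun=> 1) (fun s => - F s).
  by move=> [K hK]; exists K => s Ss; rewrite normcN; exact: hK.
have domJ (F : R -> R[i]) : dominated S (fun=> 1) F ->
    dominated S (fun=> 1) (fun s => (F s)^*%C).
  move=> [K hK]; exists K => s Ss; apply: le_trans (hK s Ss).
  by case: (F s) => x y /=; rewrite sqrrN.
have eqd (F G : R -> R[i]) : (forall s, F s = G s) ->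
    dominated S (fun=> 1) F -> dominated S (fun=> 1) G.
  by move=> FG [K hK]; exists K => s Ss; rewrite -FG; exact: hK.
have chid i j : dominated S (fun=> 1) (fun s => chi (A s) i j).
  have d1 k l : dominated S (fun=> 1) (fun s => cpart1 (A s k l)).
    by have [? ? ? ?] := rA k l; exact: dom.
  have d2 k l : dominated S (fun=> 1) (fun s => cpart2 (A s k l)).
    by have [? ? ? ?] := rA k l; exact: dom.
  case: (split_ordP i) => i' ->; case: (split_ordP j) => j' ->.
  - by apply: eqd (d1 i' j') => s; rewrite /chi block_mxEul mxE.
  - by apply: eqd (d2 i' j') => s; rewrite /chi block_mxEur mxE.
  - apply: eqd (domN _ (domJ _ (d2 i' j'))) => s.
    by rewrite /chi block_mxEdl mxE; congr (- _); rewrite mxE.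
  - by apply: eqd (domJ _ (d1 i' j')) => s; rewrite /chi block_mxEdr mxE.
have mud : dominated S (fun=> 1) (fun s => (mu T s)%:C%C).
  exists (b - a) => s [Ts as_ sb]; rewrite mulr1 normc_real ger0_norm ?mu_ge0 //.
  by have [_ _ hs] := sigma_spec hT Tb sb; rewrite /mu; lra.
have [K hK] := dominated_minor_poly chid mud.
exists (`|K| + 1) => [|s Ts as_ sb]; first by have := normr_ge0 K; lra.
rewrite liouville_coeffE; apply: le_trans (Re_le_normc _) _.
apply: (le_trans (hK s _)) => //=; rewrite mulr1.
by have := ler_norm K; lra.
Qed.

End Liouville.

Theorem theorem4p13 (R : realType) (T : set R) (hT : time_scale T) (n : nat)
    (A M : R -> 'M[quat R]_n)
    (hA : rd_regressive T A) (hM : solution_matrix T A M)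
    (t t0 : R) (ht : T t) (ht0 : T t0) :
  quat_of_complex (wronskian M t) =
  Eexp T (fun tau => quat_of_complex (liouville_coeff T A tau)) t t0
    * quat_of_complex (wronskian M t0).
Proof.
case: hA => rA regA.
pose w s := complex.Re (wronskian M s).
pose v s := complex.Re (liouville_coeff T A s).
have wE s : quat_of_complex (wronskian M s) = quat_of_real (w s).
  by rewrite /w /wronskian [in LHS]det_chi_real.
have vE s : liouville_coeff T A s = (v s)%:C%C.
  rewrite /v liouville_coeffE; have := Im_minor_poly_chi (A s) (mu T s).
  by case: (minor_poly _ _) => p q /= ->.
have dw s : Tkappa T s -> real_delta_derive T w s (v s * w s).
  exact: wronskian_delta_derive.
have reg s : Tkappa T s -> 0 < 1 + mu T s * v s.
  move=> Ks; have := det_chi_gt0 (regA s Ks).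
  by rewrite det_chi_1addZ -liouville_coeffE vE /= mulr0 subr0.
have w_ge0 s : 0 <= w s by exact: det_chi_ge0.
have zero_fwd a b : T a -> T b -> a <= b -> w a = 0 -> w b = 0.
  move=> Ta Tb ab; have [C C0 vC] := liouville_coeff_bounded hT rA Ta Tb ab.
  exact: (linear_zero_forward hT Ta Tb ab C0 dw vC).
have pos_fwd a b : T a -> T b -> a <= b -> 0 < w a -> 0 < w b.
  move=> Ta Tb ab; have [C C0 vC] := liouville_coeff_bounded hT rA Ta Tb ab.
  apply: (linear_positive_forward hT Ta Tb ab C0 dw vC) => s Ts as_ sb.
  exact: reg (Tkappa_lt Ts Tb sb).
(* For b < a, a zero at b would propagate forward to a, and negative values are excluded. *)
have pos a b : T a -> T b -> 0 < w a -> 0 < w b.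
  move=> Ta Tb wa; have [ab|/ltW ba] := leP a b; first exact: pos_fwd wa.
  rewrite lt_neqAle w_ge0 andbT; apply/eqP => /esym /(zero_fwd _ _ Tb Ta ba) wa0.
  by rewrite wa0 ltxx in wa.
rewrite !wE; have [w0|w0] := eqVneq (w t0) 0.
  suff -> : w t = 0 by rewrite w0 mulr0.
  apply/eqP; rewrite eq_le w_ge0 andbT leNgt; apply/negP => /(pos _ _ ht ht0).
  by rewrite w0 ltxx.
have wt0 : 0 < w t0 by rewrite lt_neqAle eq_sym w0 w_ge0.
have wp s : T s -> 0 < w s by move=> Ts; exact: (pos _ _ ht0 Ts wt0).
rewrite (Eexp_real hT (u := v) (F := fun s => ln (w s)) ht0 ht) //.
- by rewrite -quat_of_realM -ln_div ?posrE ?wp // lnK ?posrE ?divr_gt0 ?wp // divfK.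
- by move=> s _; rewrite vE.
- move=> s Ks; have Ts : T s by case: Ks.
  apply: (delta_derive_ln (w := w) hT Ts) => //; [exact: wp | | exact: dw].
  by apply: wp; exact: sigma_mem.
Qed.
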